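(* Let $k\ge 2$, let $(X_i,T_i)$, $i=1,\dots,k$, be topological dynamical systems on compact metric spaces $(X_i,d_i)$, and let $\pi_i:X_i\to X_{i+1}$ ($1\le i\le k-1$) be factor maps. Let $\mathbf a=(a_1,\dots,a_k)\in\mathbb R^k$ with $a_1>0$ and $a_i\ge 0$ for $i\ge 2$. For each ergodic measure $\mu\in\mathcal M(X_1,T_1)$, $$\lim_{\epsilon\to0}\liminf_{n\to+\infty}\frac{-\log\mu(B^{\mathbf a}_n(x,\epsilon))}{n}=\lim_{\epsilon\to0}\limsup_{n\to+\infty}\frac{-\log\mu(B^{\mathbf a}_n(x,\epsilon))}{n}=h^{\mathbf a}_\mu(T_1)$$ for $\mu$-a.e. $x\in X_1$.
   Context: A topological dynamical system $(X,T)$ is a compact metric space $X$ with a continuous map $T:X\to X$. A factor map $\pi_i:X_i\to X_{i+1}$ is a continuous surjection with $\pi_i\circ T_i=T_{i+1}\circ\pi_i$. Let $\pi_0$ be the identity of $X_1$ and $\tau_i=\pi_i\circ\pi_{i-1}\circ\cdots\circ\pi_0:X_1\to X_{i+1}$ for $i=0,\dots,k-1$. $\mathcal M(X_1,T_1)$ is the set of $T_1$-invariant Borel probability measures on $X_1$. For $\mu\in\mathcal M(X_1,T_1)$, $$h^{\mathbf a}_\mu(T_1):=\sum_{i=1}^k a_i\,h_{\mu\circ\tau_{i-1}^{-1}}(T_i),$$ where $h_{\mu\circ\tau_{i-1}^{-1}}(T_i)$ is the measure-theoretic entropy. For $x\in X_1$, $n\in\mathbb N$, $\epsilon>0$, the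 $\mathbf a$-weighted Bowen ball is $$B^{\mathbf a}_n(x,\epsilon)=\{y\in X_1:\ d_i(T_i^j\tau_{i-1}x,T_i^j\tau_{i-1}y)<\epsilon\ \text{for } 0\le j\le\lceil(a_1+\dots+a_i)n\rceil-1,\ i=1,\dots,k\}.$$ *)

(* Defs.v *)
From HB Require Import structures.
From mathcomp Require Import all_boot all_order all_algebra.
From mathcomp Require Import all_classical all_reals all_analysis.

Set Implicit Arguments.
Unset Strict Implicit.
Unset Printing Implicit Defensive.

Import Order.TTheory GRing.Theory Num.Theory.
Import numFieldNormedType.Exports.

Local Open Scope classical_set_scope.
Local Open Scope ring_scope.

(* Measurable types of the library are pointed, so metric spaces carrying a
   Borel structure are taken nonempty; an empty space carries no probability
   measure anyway. *)
#[short(type="pmetricType")]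
HB.structure Definition PointedMetric (K : numDomainType) :=
  {M of Pointed M & Metric K M}.

Notation borel X := (g_sigma_algebraType (@open X)).

Definition topological_dynamical_system (R : realType) (X : pmetricType R)
    (T : X -> X) : Prop :=
  compact [set: X] /\ continuous T.

Definition factor_map (R : realType) (X Y : pmetricType R)
    (T : X -> X) (S : Y -> Y) (p : X -> Y) : Prop :=
  [/\ continuous p, set_surj [set: X] [set: Y] p & p \o T = S \o p].

Definition invariant_measure d (X : measurableType d) (R : realType)
    (mu : probability X R) (T : X -> X) : Prop :=
  forall A : set X, measurable A -> mu (T @^-1` A) = mu A.

Definition ergodic_measure d (X : measurableType d) (R : realType)
    (mu : probability X R) (T : X -> X) : Prop :=
  invariant_measure mu T /\
  forall A : set X, measurable A -> T @^-1` A = A ->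
    mu A = 0%E \/ mu A = 1%E.

(* Pieces of a partition may be empty or null; they do not contribute to the
   entropy. *)
Definition measurable_partition d (X : measurableType d) (I : finType)
    (xi : I -> set X) : Prop :=
  [/\ forall i, measurable (xi i), trivIset [set: I] xi &
      \bigcup_i xi i = [set: X]].

(* The join of T^-j xi for 0 <= j < n, its pieces being indexed by the words of
   length n over the index set of xi. *)
Definition dynamical_join (X : Type) (T : X -> X) (I : finType)
    (xi : I -> set X) (n : nat) : {ffun 'I_n -> I} -> set X :=
  fun w => \bigcap_(j : 'I_n) (iter j T @^-1` xi (w j)).

(* The entropies below take a mere set function so that they apply to
   [pushforward mu f] without a bundled proof that f is measurable. *)

(* ln 0 = 0, hence the convention 0 log 0 = 0. *)
Definition partition_entropy (X : Type) (R : realType) (m : set X -> \bar R)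
    (I : finType) (xi : I -> set X) : R :=
  - \sum_(i : I) fine (m (xi i)) * ln (fine (m (xi i))).

Definition entropy_wrt_partition (X : Type) (R : realType)
    (m : set X -> \bar R) (T : X -> X) (I : finType) (xi : I -> set X) : R :=
  limn (fun n => partition_entropy m (dynamical_join T xi (n := n)) / n%:R).

Definition measure_entropy d (X : measurableType d) (R : realType)
    (m : set X -> \bar R) (T : X -> X) : \bar R :=
  ereal_sup [set h : \bar R | exists N : nat, exists xi : 'I_N -> set X,
    measurable_partition xi /\ h = (entropy_wrt_partition m T xi)%:E].

(* A chain of k systems is given by families indexed by nat, of which only the
   indices i < k are relevant. Index i stands for i + 1 in the usual numbering
   X_1, ..., X_k of the spaces, so that [tau p i] maps X_1 to X_{i+1}. *)

Fixpoint tau (X : nat -> Type) (p : forall i, X i -> X i.+1) (i : nat) :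
    X 0%N -> X i :=
  match i with
  | 0 => id
  | j.+1 => p j \o tau p j
  end.

Definition weighted_entropy (R : realType) (k : nat) (X : nat -> pmetricType R)
    (T : forall i, X i -> X i) (p : forall i, X i -> X i.+1) (a : nat -> R)
    (mu : probability (borel (X 0%N)) R) : \bar R :=
  (\sum_(i < k) (a i)%:E *
     measure_entropy
       (pushforward mu (tau p i : borel (X 0%N) -> borel (X i))) (T i))%E.

Definition weighted_Bowen_ball (R : realType) (k : nat)
    (X : nat -> pmetricType R) (T : forall i, X i -> X i)
    (p : forall i, X i -> X i.+1) (a : nat -> R)
    (n : nat) (x : X 0%N) (eps : R) : set (X 0%N) :=
  [set y | forall i j : nat, (i < k)%N ->
     j%:Z <= Num.ceil ((\sum_(l < i.+1) a l) * n%:R) - 1 ->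
     mdist (iter j (T i) (tau p i x)) (iter j (T i) (tau p i y)) < eps].

(* Main.v *)
Require Import Defs.
From mathcomp Require Import all_boot all_order all_algebra.
From mathcomp Require Import all_classical all_reals all_analysis.
From mathcomp Require Import measurable_realfun lra ring.

Set Implicit Arguments.
Unset Strict Implicit.
Unset Printing Implicit Defensive.

Import Order.TTheory GRing.Theory Num.Theory.
Import numFieldNormedType.Exports.

Local Open Scope classical_set_scope.
Local Open Scope ring_scope.

(** Let mu be the ergodic measure. All comparisons of measures of atoms rest on
    one remark, [likelihood_ratio_bound]: if q n is a subprobability on the
    values of a random word F n, then almost surely q n (F n x) is at most
    exp (e n) mu (F n = F n x) for all large n, because the likelihood ratio has
    mean at most one. Each estimate of an information -log mu (atom) is obtained
    by exhibiting a suitable q.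

    The Shannon-McMillan-Breiman theorem. Let l be the infimum of the s such
    that, almost surely, the first n letters have information at most s n for
    infinitely many n; by ergodicity the liminf of the information rate is l. If
    s > l, then most points of an orbit start a block of bounded length and of
    information rate at most s. Take for q the law of a concatenation of
    independent blocks ([renewal]): cutting an orbit greedily into such blocks
    shows that a word of length n, read anywhere along the orbit, has
    information at most s n + o(n) ([window_info_le]), the exceptional points
    being rare by Birkhoff's theorem ([ae_visits_lt], proved by the same greedy
    cutting). With the same q, Gibbs' inequality bounds the Shannon entropy H_n
    of the first n letters, so that l = lim H_n / n is the entropy.

    Mixed words. The Bowen ball of x controls the letters of X_i only up to time
    (a_1 + ... + a_i) n, which leads to words reading successively coarser
    alphabets c_0, c_1, ... in consecutive time windows. Their information is
    the sum of (entropy of c_i) * (length of window i) up to o(n)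
    ([mixed_info]): the upper bound takes for q a product law; for the lower
    bound, the last window is read in the alphabet of the previous one, which
    adds at most the difference of the two informations of that window
    ([info_refine]).

    Balls. Labels of small diameter give atoms contained in the ball, hence the
    upper bound for -log mu (ball). For the lower bound, start from arbitrary
    finite partitions of the X_i with almost maximal entropy. By Lusin's theorem
    ([stable_label]) the letters of the orbit of x can be read off any orbit
    staying close to it, except when the orbit of x visits a small set. So the
    words of the points of the ball agree with the word of x outside few
    positions, which depend on x only; passing these words through a random
    noise that corrects the few wrong letters yields the q that bounds the
    measure of the ball by that of the atom of x ([noisy_bound]).

    The alphabet of level i records the labels of X_i and of all its factors
    ([chain_letter]), so that it is determined by the point of X_i and determines
    the alphabet of level i + 1; its entropy lies between that of the label of
    X_i and the entropy of X_i. *)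


(** * Random words and the likelihood ratio *)

Section RealProbability.
Context d (X : measurableType d) (R : realType) (mu : probability X R).
Implicit Types A B : set X.

Definition real_pr A : R := fine (mu A).
Local Notation pr := real_pr.

Lemma prE A : measurable A -> mu A = (pr A)%:E.
Proof. by move=> mA; rewrite /pr fineK// fin_num_measure. Qed.

Lemma pr_ge0 A : 0 <= pr A.
Proof. by rewrite fine_ge0. Qed.

Lemma prT : pr setT = 1.
Proof. by rewrite /pr probability_setT. Qed.

Lemma pr0 : pr set0 = 0.
Proof. by rewrite /pr measure0. Qed.

Lemma le_pr A B : measurable A -> measurable B -> A `<=` B -> pr A <= pr B.
Proof.
move=> mA mB AB; rewrite -lee_fin -!prE//.
by apply: le_measure => //; rewrite inE.
Qed.

Lemma pr_le1 A : measurable A -> pr A <= 1.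
Proof. by move=> mA; rewrite -prT le_pr. Qed.

Lemma prC A : measurable A -> pr (~` A) = 1 - pr A.
Proof.
move=> mA; apply: EFin_inj; rewrite -prE; last exact: measurableC.
by rewrite probability_setC// EFinB -prE.
Qed.

Lemma prU_le A B : measurable A -> measurable B -> pr (A `|` B) <= pr A + pr B.
Proof.
move=> mA mB; rewrite -lee_fin EFinD -!prE//; last exact: measurableU.
exact: measureU2.
Qed.

Lemma pr_bigcup_le (I : finType) (F : I -> set X) :
  (forall i, measurable (F i)) -> pr (\bigcup_i F i) <= \sum_i pr (F i).
Proof.
move=> mF; have -> : \bigcup_i F i = \big[setU/set0]_i F i.
  rewrite -bigcup_seq; apply: eq_bigcupl; split=> i //= _.
  by rewrite mem_index_enum.
suff [] : measurable (\big[setU/set0]_i F i) /\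
  pr (\big[setU/set0]_i F i) <= \sum_i pr (F i) by [].
elim/big_rec2 : _ => [|i s S _ [mS le]]; first by rewrite pr0.
split; first exact: measurableU.
by apply: le_trans (prU_le _ _) _ => //; rewrite lerD2l.
Qed.

Lemma pr_negligible A : measurable A -> pr A = 0 -> mu.-negligible A.
Proof. by move=> mA A0; exists A; split=> //; rewrite prE// A0. Qed.

Lemma ae_pr1 A : measurable A -> {ae mu, forall x, A x} <-> pr A = 1.
Proof.
move=> mA; split=> [|A1].
  move=> /(measure_negligible (measurableC mA)) mA0.
  have : pr (~` A) = 0 by rewrite /pr mA0.
  by rewrite prC// => /eqP; rewrite subr_eq0 => /eqP.
by apply: pr_negligible; rewrite ?prC// ?A1 ?subrr//; exact: measurableC.
Qed.

Lemma exponential_Borel_Cantelli (A : nat -> set X) (e : R) :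
  0 < e -> (forall n, measurable (A n)) ->
  (forall n, pr (A n) <= expR (- (e * n%:R))) ->
  {ae mu, forall x, \forall n \near \oo, ~ A n x}.
Proof.
move=> e0 mA leA; set r := expR (- e).
have r1 : r < 1 by rewrite expR_lt1 oppr_lt0.
have leAr n : (mu (A n) <= (r ^+ n)%:E)%E.
  by rewrite prE// lee_fin -expRM_natr mulNr.
have mlim : measurable (lim_sup_set A).
  apply: bigcap_measurable => // n _.
  by apply: bigcup_measurable => j _.
exists (lim_sup_set A); split=> //; last first.
  move=> x /= nx n _; apply: contrapT => nn; apply: nx; exists n => // j /= nj Aj.
  by apply: nn; exists j.
apply: lim_sup_set_cvg0 => //.
apply: (@le_lt_trans _ _ ((1 - r)^-1)%:E); last by rewrite ltry.
apply: lime_le; first exact: is_cvg_nneseries.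
apply: nearW => n; apply: (@le_trans _ _ (\sum_(0 <= k < n) (r ^+ k)%:E)%E).
  by apply: lee_sum => k _; exact: leAr.
rewrite sumEFin lee_fin big_mkord -div1r ler_pdivlMr ?subr_gt0//.
have := subrX1 r n; rewrite mulrC.
rewrite -[LHS]opprB -[X in _ * X]opprB mulrN => /oppr_inj <-.
by rewrite gerBl exprn_ge0// expR_ge0.
Qed.

(** For a finite codomain this is measurability for the discrete sigma-algebra;
    such functions are the letters and words below. *)
Definition measurable_label (W : Type) (F : X -> W) : Prop :=
  forall w, measurable (F @^-1` [set w]).

Lemma measurable_label_pred (W : finType) (F : X -> W) (P : W -> Prop) :
  measurable_label F -> measurable [set x | P (F x)].
Proof.
move=> mF; rewrite (_ : [set x | _] = \bigcup_(w in P) (F @^-1` [set w])).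
  by apply: fin_bigcup_measurable => //; exact: finite_finset.
by apply/seteqP; split=> [x Px|x [w Pw /= ->]]//; exists (F x).
Qed.

Lemma measurable_label_comp (W W' : finType) (F : X -> W) (r : W -> W') :
  measurable_label F -> measurable_label (r \o F).
Proof. by move=> mF w; apply: (measurable_label_pred (fun v => r v = w)). Qed.

Lemma measurable_label_pair (W W' : Type) (F : X -> W) (G : X -> W') :
  measurable_label F -> measurable_label G ->
  measurable_label (fun x => (F x, G x)).
Proof.
move=> mF mG [w w'].
rewrite (_ : _ @^-1` _ = F @^-1` [set w] `&` G @^-1` [set w']).
  exact: measurableI.
by apply/seteqP; split=> x /= [-> ->].
Qed.

Lemma measurable_label_ffun (I : finType) (W : Type) (F : I -> X -> W) :
  (forall i, measurable_label (F i)) ->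
  measurable_label (fun x => [ffun i => F i x]).
Proof.
move=> mF w.
rewrite (_ : _ @^-1` _ = \bigcap_(i in [set: I]) (F i @^-1` [set w i])).
  apply: fin_bigcap_measurable => [|i _]; first exact: finite_finset.
  exact: (mF i (w i)).
apply/seteqP; split=> [x <- i _ /=|x Fx]; first by rewrite ffunE.
by apply/ffunP => i; rewrite ffunE; exact: Fx.
Qed.

Lemma pr_label_sumI (W : finType) (F : X -> W) (P : pred W) B :
  measurable_label F -> measurable B ->
  pr ([set x | P (F x)] `&` B) = \sum_(w | P w) pr (F @^-1` [set w] `&` B).
Proof.
move=> mF mB; apply: EFin_inj; rewrite -prE; last first.
  by apply: measurableI => //; exact: (measurable_label_pred P).
rewrite (_ : _ `&` B =
    \bigcup_(w in [set` enum P]) (F @^-1` [set w] `&` B)); last first.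
  apply/seteqP; split=> [x [Px Bx]|x [w]].
    by exists (F x) => //=; rewrite mem_enum.
  by move=> /= + [/= -> Bx]; rewrite mem_enum.
rewrite measure_fin_bigcup//; last first.
- by move=> w _; apply: measurableI.
- by move=> w w' _ _ [x [[/= -> _] [/= -> _]]].
rewrite -fsbig_seq ?enum_uniq// big_enum/= -sumEFin.
by apply: eq_bigr => w _; rewrite prE//; apply: measurableI.
Qed.

Lemma pr_label_sum (W : finType) (F : X -> W) (P : pred W) :
  measurable_label F ->
  pr [set x | P (F x)] = \sum_(w | P w) pr (F @^-1` [set w]).
Proof.
move=> mF; have := pr_label_sumI P mF measurableT; rewrite setIT => ->.
by apply: eq_bigr => w _; rewrite setIT.
Qed.

Lemma pr_label_sum1 (W : finType) (F : X -> W) :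
  measurable_label F -> \sum_w pr (F @^-1` [set w]) = 1.
Proof.
move=> mF; rewrite -(pr_label_sum xpredT)// -prT; congr pr.
by apply/seteqP; split.
Qed.

Definition fibre (W : Type) (F : X -> W) (x : X) : set X :=
  [set y | F y = F x].

Lemma measurable_fibre (W : Type) (F : X -> W) x :
  measurable_label F -> measurable (fibre F x).
Proof. by move=> /(_ (F x)). Qed.

(** Markov's inequality applied to the likelihood ratio of a subprobability q
    on words with respect to the law of the random word: the ratio has integral
    at most one, so it exceeds exp (e n) only on a set of measure exp (- e n),
    and these measures are summable. *)
Lemma likelihood_ratio_bound (W : nat -> finType) (F : forall n, X -> W n)
    (q : forall n, W n -> R) (e : R) :
  0 < e -> (forall n, measurable_label (F n)) -> (forall n w, 0 <= q n w) ->
  (forall n, \sum_w q n w <= 1) ->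
  {ae mu, forall x, \forall n \near \oo,
    q n (F n x) <= expR (e * n%:R) * pr (fibre (F n) x)}.
Proof.
move=> e0 mF q0 q1.
pose P n w := expR (e * n%:R) * pr (F n @^-1` [set w]) < q n w.
pose A n := [set x | P n (F n x)].
have mA n : measurable (A n) by apply: (measurable_label_pred (P n)).
suff : {ae mu, forall x, \forall n \near \oo, ~ A n x}.
  by apply: filterS => x; apply: filterS => n /negP; rewrite -leNgt.
apply: (exponential_Borel_Cantelli e0) => // n.
rewrite expRN -[_^-1]mul1r ler_pdivlMr ?expR_gt0//.
apply: le_trans (q1 n); rewrite pr_label_sum// mulr_suml.
rewrite [leRHS](bigID (P n))/= -[leLHS]addr0; apply: lerD.
  by apply: ler_sum => w /ltW; rewrite mulrC.
by apply: sumr_ge0.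
Qed.

End RealProbability.

(** * Information *)

Section Information.
Context d (X : measurableType d) (R : realType) (mu : probability X R).
Local Notation pr := (real_pr mu).

(** Only the partition into fibres of F matters, so that F may take its values
    in any type and words over different alphabets can be compared. *)
Definition information (W : Type) (F : X -> W) (x : X) : R := - ln (pr (fibre F x)).
Local Notation info := information.

Lemma ae_fibre_gt0 (W : finType) (F : X -> W) :
  measurable_label F -> {ae mu, forall x, 0 < pr (fibre F x)}.
Proof.
move=> mF; pose P w := pr (F @^-1` [set w]) == 0.
have : mu.-negligible [set x | P (F x)].
  apply: pr_negligible; first exact: (measurable_label_pred P).
  by rewrite pr_label_sum// big1// => w /eqP.
apply: negligibleS => x /= /negP; rewrite lt0r pr_ge0 andbT negbK.
by rewrite /P.
Qed.

Lemma ae_fibres_gt0 (W : nat -> finType) (F : forall n, X -> W n) :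
  (forall n, measurable_label (F n)) ->
  {ae mu, forall x, forall n, 0 < pr (fibre (F n) x)}.
Proof. by move=> mF; apply/ae_foralln => n; exact: ae_fibre_gt0. Qed.

Lemma info_ge0 (W : Type) (F : X -> W) x : measurable_label F -> 0 <= info F x.
Proof.
by move=> mF; rewrite oppr_ge0 ln_le0// pr_le1//; exact: measurable_fibre.
Qed.

Lemma le_info (W V : Type) (F : X -> W) (G : X -> V) x :
  measurable_label F -> measurable_label G -> 0 < pr (fibre F x) ->
  fibre F x `<=` fibre G x -> info G x <= info F x.
Proof.
move=> mF mG F0 FG; rewrite lerN2.
have leFG : pr (fibre F x) <= pr (fibre G x).
  by apply: le_pr => //; exact: measurable_fibre.
by rewrite ler_ln// posrE// (lt_le_trans F0).
Qed.

Lemma eq_info (W V : Type) (F : X -> W) (G : X -> V) x :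
  fibre F x = fibre G x -> info F x = info G x.
Proof. by rewrite /information => ->. Qed.

Lemma fibre_window (W : Type) (f : nat -> X -> W) m n x :
  fibre (fun y => [ffun i : 'I_n => f (m + i)%N y]) x =
  [set y | forall t, (m <= t < m + n)%N -> f t y = f t x].
Proof.
apply/seteqP; split=> y.
  move=> /ffunP yx t /andP[mt tmn].
  have tn : (t - m < n)%N by rewrite ltn_subLR.
  by have := yx (Ordinal tn); rewrite !ffunE/= subnKC.
move=> yx; apply/ffunP => i; rewrite !ffunE; apply: yx.
by rewrite leq_addr ltn_add2l ltn_ord.
Qed.

Lemma fibre_pair (W V : Type) (F : X -> W) (G : X -> V) x :
  fibre (fun y => (F y, G y)) x = fibre F x `&` fibre G x.
Proof. by apply/seteqP; split=> y; rewrite /fibre/= => -[-> ->]. Qed.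

(** The relation u <= v + o(n) almost surely. *)
Definition evle (u v : nat -> X -> R) : Prop := forall e : R, 0 < e ->
  {ae mu, forall x, \forall n \near \oo, u n x <= v n x + e * n%:R}.

Lemma evleW u v : {ae mu, forall x, forall n, u n x <= v n x} -> evle u v.
Proof.
move=> uv e e0; apply: filterS uv => x uv; apply: nearW => n.
by apply: le_trans (uv n) _; rewrite lerDl mulr_ge0// ltW.
Qed.

Lemma evle_trans v u w : evle u v -> evle v w -> evle u w.
Proof.
move=> uv vw e e0; have e20 : 0 < e / 2 by rewrite divr_gt0.
have := vw _ e20; have := uv _ e20; apply: filterS2 => x; apply: filterS2 => n.
by move: (u n x) (v n x) (w n x) (n%:R : R) => *; lra.
Qed.

Lemma evleD u v u' v' : evle u v -> evle u' v' ->
  evle (fun n x => u n x + u' n x) (fun n x => v n x + v' n x).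
Proof.
move=> uv uv' e e0; have e20 : 0 < e / 2 by rewrite divr_gt0.
have := uv' _ e20; have := uv _ e20; apply: filterS2 => x; apply: filterS2 => n.
by move: (u n x) (v n x) (u' n x) (v' n x) (n%:R : R) => *; lra.
Qed.

Lemma evle_const (a b : R) :
  evle (fun n _ => a * n%:R) (fun n _ => b * n%:R) -> a <= b.
Proof.
move=> ab; apply/ler_addgt0Pr => e e0.
have pf : ProperFilter (almost_everywhere mu).
  have mu0 : (0 < mu setT)%E by rewrite probability_setT lte01.
  exact: ae_properfilter_algebraOfSetsType.
have [x [N _ Nx]] := @filter_ex _ _ pf _ (ab _ e0).
have := Nx N.+1 (leqnSn N); rewrite -mulrDl ler_pM2r//.
Qed.

(** The comparison law is q (u, v) = P (F = u, G' = r v) P (G = v | G' = r v)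
    with G' = r o G: given the coarse word G', the fine word G is drawn
    independently of F. Hence replacing G by G' in the pair lowers the
    information by at most the difference of those of G and G'. *)
Lemma info_refine (U V V' : nat -> finType) (F : forall n, X -> U n)
    (G : forall n, X -> V n) (r : forall n, V n -> V' n) :
  (forall n, measurable_label (F n)) -> (forall n, measurable_label (G n)) ->
  evle (fun n x => info (fun y => (F n y, G n y)) x + info (r n \o G n) x)
       (fun n x => info (fun y => (F n y, r n (G n y))) x + info (G n) x).
Proof.
move=> mF mG.
have mG' n : measurable_label (r n \o G n) by exact: measurable_label_comp.
pose W n : finType := (U n * V n)%type.
pose FG n : X -> W n := fun x => (F n x, G n x).
pose FG' n x := (F n x, r n (G n x)).
pose p' n v := pr ((r n \o G n) @^-1` [set r n v]).
pose q n (w : W n) := pr (FG' n @^-1` [set (w.1, r n w.2)]) *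
  (pr (G n @^-1` [set w.2]) / p' n w.2).
have q0 n w : 0 <= q n w.
  by rewrite mulr_ge0// ?divr_ge0// pr_ge0.
have q1 n : \sum_w q n w <= 1.
  rewrite -[leRHS](pr_label_sum1 mu (mG n)) -(pair_big xpredT xpredT (fun u v => q n (u, v)))/=.
  rewrite exchange_big/=; apply: ler_sum => v _.
  rewrite /q/= -mulr_suml.
  rewrite (_ : \sum_(i in U n) _ = p' n v).
    rewrite mulrCA ler_piMr ?pr_ge0//.
    have [->|p0] := eqVneq (p' n v) 0; first by rewrite mul0r.
    by rewrite divff.
  rewrite /p'; have <- : [set x | xpredT (F n x)] `&` (r n \o G n) @^-1` [set r n v] =
      (r n \o G n) @^-1` [set r n v] by apply/seteqP; split=> [x []|x].
  rewrite (pr_label_sumI mu xpredT (mF n) (mG' n _)).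
  apply: eq_bigr => u _; congr (fine (mu _)).
  by apply/seteqP; split=> x; rewrite /FG'/=; [case=> -> ->|case=> -> ->].
move=> e e0.
have mFG n : measurable_label (FG n) by exact: measurable_label_pair.
have mFG' n : measurable_label (FG' n).
  exact: (measurable_label_pair (mF n) (mG' n)).
move: (ae_fibres_gt0 mG) (ae_fibres_gt0 mFG).
move: (likelihood_ratio_bound mu e0 mFG q0 q1).
apply: filterS3 => x + G0 FG0; apply: filterS => n; rewrite /q/=.
move: (G0 n) (FG0 n) => {}G0 {}FG0.
have G'0 : 0 < pr (fibre (r n \o G n) x).
  apply: lt_le_trans G0 _; apply: le_pr; try exact: measurable_fibre.
  by move=> y; rewrite /fibre/= => ->.
have FG'0 : 0 < pr (fibre (FG' n) x).
  apply: lt_le_trans FG0 _; apply: le_pr; try exact: measurable_fibre.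
  by move=> y; rewrite /fibre/FG'/= => -[-> ->].
rewrite mulrA ler_pdivrMr// => le.
rewrite /information -!opprD -!lnM ?posrE// -[X in _ <= _ + X]expRK.
rewrite lerNl opprD opprK lerBlDr -lnM ?posrE ?mulr_gt0 ?expR_gt0//.
rewrite ler_ln ?posrE ?mulr_gt0 ?expR_gt0//.
by rewrite [leRHS]mulrC mulrA.
Qed.

(** The case of a trivial coarse word. *)
Lemma info_pair (U V : nat -> finType) (F : forall n, X -> U n)
    (G : forall n, X -> V n) :
  (forall n, measurable_label (F n)) -> (forall n, measurable_label (G n)) ->
  evle (fun n x => info (fun y => (F n y, G n y)) x)
       (fun n x => info (F n) x + info (G n) x).
Proof.
move=> mF mG e e0; move: (info_refine (fun n (_ : V n) => tt) mF mG e0).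
apply: filterS => x; apply: filterS => n.
rewrite [X in _ + X <= _]/information (_ : fibre _ _ = setT); last first.
  by apply/seteqP; split.
rewrite prT ln1 oppr0 addr0.
by rewrite [X in _ <= X + _ + _](@eq_info _ _ _ (F n))//;
  apply/seteqP; split=> y; rewrite /fibre/= => -[->].
Qed.

(** ** Random noise on words *)

Section Noise.
Variables (A : finType) (t : R).
Hypothesis t01 : 0 < t < 1.

(** Each letter is kept with probability 1 - t and resampled uniformly with
    probability t. *)
Let noise (b a : A) : R := (1 - t) * (b == a)%:R + t / #|A|%:R.

Let alphabet_gt0 (a : A) : 0 < #|A|%:R :> R.
Proof. by rewrite ltr0n; apply/card_gt0P; exists a. Qed.

Let noise_sum b : \sum_a noise b a = 1.
Proof.
rewrite big_split/= -mulr_sumr (bigD1 b)//= eqxx big1 ?addr0 ?mulr1; last first.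
  by move=> a; rewrite eq_sym => /negbTE->.
by rewrite sumr_const -[_ / _ *+ _]mulr_natr divfK ?subrK// gt_eqF// (alphabet_gt0 b).
Qed.

Let noise_ge b a : t / #|A|%:R <= noise b a.
Proof.
have /andP[t0 t1] := t01.
by rewrite lerDr mulr_ge0// subr_ge0 ltW.
Qed.

Let noise_ge0 b a : 0 <= noise b a.
Proof.
have /andP[t0 t1] := t01; apply: le_trans (noise_ge b a).
by rewrite divr_ge0// ltW.
Qed.

Let noise_refl a : 1 - t <= noise a a.
Proof.
have /andP[t0 t1] := t01.
by rewrite /noise eqxx mulr1 lerDl divr_ge0// ltW.
Qed.

(** If every point of B has an f-word agreeing with the g-word of x outside
    few positions, then B is hardly larger than the g-cylinder of x: passing
    the f-word through the noise gives a random word which equals the g-word of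
    x with probability at least mu(B) times the probability that the noise
    makes the required corrections. *)
Lemma noisy_bound (M : nat -> nat) (f g : forall n, 'I_(M n) -> X -> A) (e : R) :
  0 < e -> (forall n i, measurable_label (f n i)) ->
  (forall n i, measurable_label (g n i)) ->
  {ae mu, forall x, \forall n \near \oo,
    forall (B : set X) (J : {set 'I_(M n)}), measurable B ->
    (forall y i, B y -> i \notin J -> f n i y = g n i x) ->
    pr B * ((1 - t) ^+ M n * (t / #|A|%:R) ^+ #|J|) <=
      expR (e * n%:R) * pr (fibre (fun y => [ffun i => g n i y]) x)}.
Proof.
move=> e0 mf mg; have /andP[t0 t1] := t01.
pose W n : finType := {ffun 'I_(M n) -> A}.
pose wf n : X -> W n := fun y => [ffun i => f n i y].
pose wg n : X -> W n := fun y => [ffun i => g n i y].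
have mwf n : measurable_label (wf n) by exact: measurable_label_ffun.
have mwg n : measurable_label (wg n) by exact: measurable_label_ffun.
pose q n (w : W n) := \sum_(v : W n)
  pr (wf n @^-1` [set v]) * \prod_i noise (v i) (w i).
have q0 n w : 0 <= q n w.
  by apply: sumr_ge0 => v _; rewrite mulr_ge0 ?pr_ge0// prodr_ge0.
have q1 n : \sum_w q n w <= 1.
  rewrite /q exchange_big/= -[leRHS](pr_label_sum1 mu (mwf n)).
  apply: ler_sum => v _; rewrite -mulr_sumr.
  suff <- : \prod_(i < M n) \sum_a noise (v i) a =
      \sum_(w : W n) \prod_i noise (v i) (w i).
    by rewrite big1 ?mulr1// => i _; exact: noise_sum.
  by rewrite bigA_distr_bigA.
move: (likelihood_ratio_bound mu e0 mwg q0 q1).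
apply: filterS => x; apply: filterS => n qle B J mB BJ; apply: le_trans qle.
pose P (v : W n) := [forall (i | i \notin J), v i == g n i x].
have leB : pr B <= pr [set y | P (wf n y)].
  apply: le_pr => //; first exact: (measurable_label_pred P).
  move=> y By /=; apply/forall_inP => i iJ; rewrite ffunE; apply/eqP.
  exact: BJ.
have c0 : 0 <= (1 - t) ^+ M n * (t / #|A|%:R) ^+ #|J|.
  by rewrite mulr_ge0// exprn_ge0 ?subr_ge0 ?divr_ge0// ltW.
apply: le_trans (ler_wpM2r c0 leB) _.
rewrite pr_label_sum// mulr_suml /q [leRHS](bigID P)/= -[leLHS]addr0.
apply: lerD; last by apply: sumr_ge0 => v _; rewrite mulr_ge0 ?pr_ge0// prodr_ge0.
apply: ler_sum => v /forall_inP Pv; apply: ler_wpM2l; first exact: pr_ge0.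
rewrite [leRHS](bigID (mem J))/= mulrC; apply: ler_pM.
- by rewrite exprn_ge0// divr_ge0// ltW.
- by rewrite exprn_ge0// subr_ge0 ltW.
- rewrite -prodr_const; apply: ler_prod => i _.
  by rewrite noise_ge divr_ge0// ltW.
apply: (@le_trans _ _ (\prod_(i < M n | i \notin J) (1 - t))).
  rewrite prodr_const; apply: ler_wiXn2l.
  - by rewrite subr_ge0 ltW.
  - by rewrite gerBl ltW.
  - by rewrite -[leqRHS]card_ord max_card.
apply: ler_prod => i iJ; rewrite subr_ge0 ltW//=.
by have /eqP-> := Pv i iJ; rewrite ffunE noise_refl.
Qed.

End Noise.

(** ** Expectations of simple functions *)

(** A bound by a weighted count of visits that holds at every point bounds the
    mean of a function of a random word; this is the only place where an
    integral is taken. *)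
Lemma expectation_count_le (W I : finType) (F : X -> W) (G : W -> R)
    (B : I -> set X) (a : R) (b : I -> R) :
  measurable_label F -> (forall i, measurable (B i)) ->
  (forall w, 0 <= G w) -> 0 <= a -> (forall i, 0 <= b i) ->
  (forall x, G (F x) <= a + \sum_i b i * \1_(B i) x) ->
  \sum_w pr (F @^-1` [set w]) * G w <= a + \sum_i b i * pr (B i).
Proof.
move=> mF mB G0 a0 b0 le.
have iE (D : set X) c : measurable D -> 0 <= c ->
    (\int[mu]_x (c * \1_D x)%:E = (c * pr D)%:E)%E.
  move=> mD c0; under eq_integral do rewrite EFinM.
  rewrite ge0_integralZl_EFin//.
  - by rewrite integral_indic// setIT EFinM; congr (_ * _)%E; exact: prE.
  - exact/measurable_EFinP/measurable_indic.
have mi (D : set X) c : measurable D ->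
    measurable_fun setT (fun x => (c * \1_D x)%:E : \bar R).
  by move=> mD; apply/measurable_EFinP/measurable_funM => //; exact: measurable_indic.
rewrite -lee_fin.
have -> : (\sum_w pr (F @^-1` [set w]) * G w)%:E =
    (\int[mu]_x (\sum_w (G w * \1_(F @^-1` [set w]) x)%:E))%E.
  rewrite ge0_integral_sum//; last 2 first.
  - by move=> w; apply: mi; exact: mF.
  - by move=> w x _; rewrite lee_fin mulr_ge0.
  under [in RHS]eq_bigr do rewrite (iE _ _ (mF _)) ?G0//.
  by rewrite sumEFin/=; congr EFin; apply: eq_bigr => w _; rewrite mulrC.
have -> : (a + \sum_i b i * pr (B i))%:E =
    (\int[mu]_x ((a * \1_setT x)%:E + \sum_i (b i * \1_(B i) x)%:E))%E.
  rewrite ge0_integralD//; last 4 first.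
  - by move=> x _; rewrite lee_fin mulr_ge0.
  - exact: mi.
  - by move=> x _; apply: sume_ge0 => i _; rewrite lee_fin mulr_ge0.
  - by apply: emeasurable_sum => i; exact: mi.
  rewrite ge0_integral_sum//; last 2 first.
  - by move=> i; exact: mi.
  - by move=> i x _; rewrite lee_fin mulr_ge0.
  rewrite iE//; under [in RHS]eq_bigr do rewrite iE//.
  by rewrite sumEFin EFinD prT mulr1.
apply: ge0_le_integral => //.
- by move=> x _; apply: sume_ge0 => w _; rewrite lee_fin mulr_ge0.
- by apply: emeasurable_sum => w; apply: mi; exact: mF.
- by apply: emeasurable_funD; [exact: mi|apply: emeasurable_sum => i; exact: mi].
move=> x _; rewrite !sumEFin -EFinD lee_fin indicT/= mulr1.
apply: le_trans (le x); rewrite (bigD1 (F x))//= big1 => [|w /eqP wF].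
  by rewrite addr0 indicE mem_set// mulr1.
by rewrite indicE memNset ?mulr0//= => /esym.
Qed.

End Information.

(** * Visits of an ergodic orbit *)

Section Measurability.
Context d (X : measurableType d).

Lemma measurable_label_bool (A : set X) :
  measurable A -> measurable_label (fun x => x \in A).
Proof.
move=> mA [].
  rewrite (_ : _ @^-1` _ = A)//.
  by apply/seteqP; split=> x; [exact: set_mem|exact: mem_set].
rewrite (_ : _ @^-1` _ = ~` A); first exact: measurableC.
apply/seteqP; split=> x /= => [xA Ax|]; last exact: memNset.
by rewrite mem_set in xA.
Qed.

Lemma measurable_label_cst (W : eqType) (v : W) :
  measurable_label (fun _ : X => v).
Proof.
move=> w; have [->|/eqP vw] := eqVneq v w.
  by rewrite (_ : _ @^-1` _ = setT)//; apply/seteqP; split.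
by rewrite (_ : _ @^-1` _ = set0)//; apply/seteqP; split.
Qed.

Lemma measurable_iter (T : X -> X) n :
  measurable_fun setT T -> measurable_fun setT (iter n T).
Proof.
move=> mT; elim: n => [|n ih]; first exact: measurable_id.
exact: measurableT_comp.
Qed.

Lemma measurable_preimage (f : X -> X) A :
  measurable_fun setT f -> measurable A -> measurable (f @^-1` A).
Proof. by move=> mf mA; rewrite -[_ @^-1` _]setTI; exact: mf. Qed.

Lemma measurable_label_iter (W : Type) (F : X -> W) (T : X -> X) n :
  measurable_fun setT T -> measurable_label F ->
  measurable_label (fun x => F (iter n T x)).
Proof.
move=> mT mF w.
exact: (measurable_preimage (measurable_iter n mT) (mF w)).
Qed.

Lemma lim_sup_setP (A : nat -> set X) x :
  lim_sup_set A x <-> forall n, exists2 j, (n <= j)%N & A j x.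
Proof.
split=> [Ax n|Ax n _]; first by have [j /= nj Aj] := Ax n I; exists j.
by have [j nj Aj] := Ax n; exists j.
Qed.

Lemma measurable_lim_sup_set (A : nat -> set X) :
  (forall n, measurable (A n)) -> measurable (lim_sup_set A).
Proof.
move=> mA; apply: bigcap_measurable => // n _.
by apply: bigcup_measurable => j _.
Qed.

Definition first_time_in (A : nat -> set X) n0 L : set X :=
  \bigcup_(n in [set n | n0 <= n <= L]%N) A n.

Lemma measurable_first_time_in (A : nat -> set X) n0 L :
  (forall n, measurable (A n)) -> measurable (first_time_in A n0 L).
Proof. by move=> mA; apply: bigcup_measurable. Qed.

End Measurability.

Section Ergodic.
Context d (X : measurableType d) (R : realType) (mu : probability X R).
Variable T : X -> X.
Hypothesis mT : measurable_fun setT T.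
Hypothesis erg : ergodic_measure mu T.
Local Notation pr := (real_pr mu).

Lemma pr_iter n A : measurable A -> pr (iter n T @^-1` A) = pr A.
Proof.
move=> mA; elim: n => // n ih.
rewrite -[RHS]ih /real_pr -(erg.1 (iter n T @^-1` A)); last first.
  exact: measurable_preimage (measurable_iter n mT) mA.
by congr (fine (mu _)); apply/seteqP; split=> x /=; rewrite -iterSr.
Qed.

(** If the events A n occur infinitely often almost surely, then most points
    meet one of them at a time between n0 and some fixed L. *)
Lemma ae_lim_sup_set_small (A : nat -> set X) n0 e :
  (forall n, measurable (A n)) -> pr (lim_sup_set A) = 1 -> 0 < e ->
  exists L, pr (~` first_time_in A n0 L) < e.
Proof.
move=> mA A1 e0; pose D := first_time_in A n0.
have mD L : measurable (D L) by exact: measurable_first_time_in.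
have mU : measurable (\bigcup_L D L) by apply: bigcup_measurable.
have U1 : pr (\bigcup_L D L) = 1.
  apply/eqP; rewrite eq_le pr_le1//= -A1; apply: le_pr => //.
    exact: measurable_lim_sup_set.
  move=> x /lim_sup_setP/(_ n0)[j nj Ajx].
  by exists j => //; exists j => //=; rewrite nj leqnn.
have : mu \o D @ \oo --> mu (\bigcup_L D L).
  apply: nondecreasing_cvg_mu => // n m nm; apply/subsetPset => x [j /= + Ajx].
  by move=> /andP[n0j jn]; exists j => //=; rewrite n0j (leq_trans jn).
rewrite prE// U1 => /fine_cvgP[_] /cvgrPdist_lt/(_ _ e0)[N _ /(_ N (leqnn N))].
rewrite /= -/(pr (D N)) => DN; exists N; rewrite prC//.
by apply: le_lt_trans DN; exact: ler_norm.
Qed.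

(** The intersection E satisfies only E `<=` T^-1 E, while ergodicity concerns
    strictly invariant sets; the increasing union of the preimages of E is one,
    of the same measure as E. *)
Lemma zero_one_seq (F : nat -> set X) :
  (forall q, measurable (F q)) -> (forall q, F q.+1 `<=` T @^-1` F q) ->
  pr (\bigcap_q F q) = 0 \/ pr (\bigcap_q F q) = 1.
Proof.
move=> mF FT; set E := \bigcap_q F q.
have mE : measurable E by apply: bigcap_measurable.
have ET : E `<=` T @^-1` E by move=> x Ex q _; apply: FT; exact: Ex.
pose D n := iter n T @^-1` E; pose U := \bigcup_n D n.
have mD n : measurable (D n).
  exact: measurable_preimage (measurable_iter n mT) mE.
have mU : measurable U by apply: bigcup_measurable.
have DS n : D n `<=` D n.+1 by move=> x; exact: ET.
have TU : T @^-1` U = U.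
  apply/seteqP; split=> x [n _] Dn.
    by exists n.+1 => //; rewrite /D/= -iterS iterSr.
  by exists n => //; rewrite /D/= -iterSr; exact: DS.
have UE : pr U = pr E.
  have : mu \o D @ \oo --> mu U.
    apply: nondecreasing_cvg_mu => // n m; elim: m => [|m ih].
      by rewrite leqn0 => /eqP->.
    rewrite leq_eqVlt => /predU1P[->//|/ih/subsetPset nm].
    by apply/subsetPset => x /nm; exact: DS.
  rewrite (_ : mu \o D = cst (mu E)); last first.
    by apply/funext => n /=; rewrite !prE// pr_iter.
  move=> /(cvg_lim (@ereal_hausdorff R)) UE.
  by rewrite /real_pr -UE lim_cst//; exact: ereal_hausdorff.
have [U0|U1] := erg.2 _ mU TU; [left|right]; rewrite -UE.
  by rewrite /real_pr U0.
by rewrite /real_pr U1.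
Qed.

(** A zero-one law for events indexed by a threshold, when applying T may
    slightly increase the threshold: limsup events about averages are of this
    kind, as shifting an average by one step perturbs it a little. *)
Lemma zero_one (F : R -> set X) (s s' : R) :
  (forall r, measurable (F r)) ->
  (forall r r', r < r' -> F r `<=` F r' /\ F r `<=` T @^-1` F r') ->
  s < s' -> pr (F s) = 0 \/ pr (F s') = 1.
Proof.
(* A sequence of thresholds decreasing strictly from s' to s. *)
move=> mF FT ss'; pose r (q : nat) := s + (s' - s) / q.+1%:R.
have sr q : s < r q by rewrite ltrDl divr_gt0// subr_gt0.
have rS q : r q.+1 < r q.
  by rewrite ltrD2l ltr_pM2l ?subr_gt0// ltf_pV2 ?posrE// ltr_nat.
have [||E0|E1] := @zero_one_seq (fun q => F (r q)).
- by move=> q; exact: mF.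
- by move=> q; exact: (FT _ _ (rS q)).2.
- left; apply/eqP; rewrite eq_le pr_ge0 andbT -E0; apply: le_pr => //.
    by apply: bigcap_measurable => // q _; exact: mF.
  by move=> x Fx q _; exact: (FT _ _ (sr q)).1.
right; apply/eqP; rewrite eq_le pr_le1//= -E1; apply: le_pr => //.
  by apply: bigcap_measurable => // q _; exact: mF.
by move=> x /(_ 0%N I); rewrite /r divr1 addrC subrK.
Qed.

Definition orbit_visits (A : set X) (M : nat) (x : X) : R :=
  \sum_(i < M) \1_A (iter i T x).

Lemma visitsD A m n x :
  orbit_visits A (m + n) x = orbit_visits A m x + orbit_visits A n (iter m T x).
Proof.
rewrite /orbit_visits big_split_ord/=; congr (_ + _).
by apply: eq_bigr => i _; rewrite -iterD addnC.
Qed.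

Lemma visitsS A n x : orbit_visits A n.+1 x = \1_A x + orbit_visits A n (T x).
Proof. by rewrite -add1n visitsD /orbit_visits big_ord1. Qed.

Lemma visits_ge0 A n x : 0 <= orbit_visits A n x.
Proof. exact: sumr_ge0. Qed.

Lemma measurable_visits A n (P : R -> Prop) :
  measurable A -> measurable [set x | P (orbit_visits A n x)].
Proof.
move=> mA; pose F x := [ffun i : 'I_n => iter i T x \in A].
pose G (w : {ffun 'I_n -> bool}) : R := \sum_(i < n) (w i)%:R.
have mF : measurable_label F.
  apply: measurable_label_ffun => i.
  exact: (measurable_label_iter i mT (measurable_label_bool mA)).
rewrite (_ : [set x | _] = [set x | P (G (F x))]).
  exact: (measurable_label_pred (P \o G)).
by apply/seteqP; split=> x /=; congr P; apply: eq_bigr => i _; rewrite ffunE indicE.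
Qed.

(** The upper half of Birkhoff's theorem, for indicator functions. If visits
    were too frequent infinitely often almost surely, then up to a set of
    small measure every point would start a segment of bounded length with too
    many visits; concatenating such segments along an orbit gives too many
    visits up to every large time M, which contradicts the mean number of
    visits. *)
Lemma ae_visits_lt (A : set X) (s : R) : measurable A -> pr A < s ->
  {ae mu, forall x, \forall M \near \oo, orbit_visits A M x < s * M%:R}.
Proof.
move=> mA As.
(* The sign makes the events increase with the threshold r. *)
pose E r M := [set x | - r * M%:R <= orbit_visits A M x].
pose F r := lim_sup_set (E r).
have mE r M : measurable (E r M) by exact: (measurable_visits M (fun v => _ <= v)).
have mF r : measurable (F r) by apply: measurable_lim_sup_set => M; exact: mE.
have [s1 As1 s1s] : exists2 s1, pr A < s1 & s1 < s.
  by exists ((pr A + s) / 2); lra.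
have s10 : 0 < s1 by apply: le_lt_trans As1; exact: pr_ge0.
have [||Fs0|Fs1] := @zero_one F (- s) (- s1) mF; rewrite ?ltrN2//.
- move=> r r' rr'; split=> x /lim_sup_setP Fx; apply/lim_sup_setP => n.
    have [M nM] := Fx n; rewrite /E/= => le; exists M => //.
    by apply: le_trans le; rewrite ler_wpM2r// lerN2 ltW.
  pose N := (Num.truncn ((1 + `|r'|) / (r' - r))).+1.
  have [M] := Fx (maxn n.+1 N.+1).
  rewrite geq_max => /andP[nM NM]; rewrite /E/=.
  case: M nM NM => // M nM NM; rewrite visitsS => le; exists M => //=.
  have : \1_A x <= 1 :> R by rewrite indicE lern1 leq_b1.
  have : (1 + `|r'|) / (r' - r) < M%:R.
    by apply: lt_le_trans (truncnS_gt _) _; rewrite ler_nat.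
  rewrite ltr_pdivrMr ?subr_gt0//.
  have := ler_norm r'; move: le; rewrite -natr1.
  move: (orbit_visits _ _ _) (\1_A x : R) (M%:R : R) `|r'| => v i m a.
  move=> h1 h2 h3 h4.
  nra.
- have := pr_negligible (mF _) Fs0; apply: negligibleS => x /= nx.
  apply/lim_sup_setP => n; apply: contrapT => nn; apply: nx; exists n => // M /= nM.
  rewrite ltNge; apply/negP => le; apply: nn; exists M => //.
  by rewrite /E/= opprK.
exfalso; pose e := (s1 - pr A) / (2 * s1).
have e0 : 0 < e by rewrite divr_gt0 ?subr_gt0 ?mulr_gt0.
have [L badL] := @ae_lim_sup_set_small (E (- s1)) 1 e (mE _) Fs1 e0.
set bad := ~` _ in badL.
have mbad : measurable bad by apply/measurableC/measurable_first_time_in.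
(* A bad point counts for s1, as much as a point of a good segment on average;
   the last L steps are given up. *)
have parse M : forall x, s1 * (M%:R - L%:R) <= orbit_visits A M x + s1 * orbit_visits bad M x.
  have [n leMn] := ubnP M; elim: n M leMn => // n ih M leMn x.
  have [ML|LM] := leqP M L.
    apply: (@le_trans _ _ 0).
      by rewrite pmulr_rle0// subr_le0 ler_nat.
    by rewrite addr_ge0 ?visits_ge0// mulr_ge0 ?visits_ge0// ltW.
  have [xbad|/contrapT [m /= /andP[m1 mL]]] := pselect (bad x).
    case: M leMn LM => // M leMn LM; rewrite !visitsS.
    have := ih M leMn (T x); rewrite -natr1 [\1_bad _]indicE mem_set//.
    have : 0 <= \1_A x :> R by [].
    move: (orbit_visits A _ _) (orbit_visits bad _ _) (\1_A x) (M%:R) (L%:R) => v b i m l.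
    rewrite /= => h1 h2; nra.
  rewrite /E/= opprK => le.
  have mM : (m <= M)%N by apply: leq_trans mL (ltnW LM).
  have := ih (M - m)%N _ (iter m T x); rewrite natrB// => ihm.
  rewrite -[M in orbit_visits A M _](subnKC mM) -[M in orbit_visits bad M _](subnKC mM) !visitsD.
  have /ihm {}ihm : (M - m < n)%N by rewrite ltn_subLR// (leq_trans leMn)// -add1n leq_add2r.
  have := visits_ge0 bad m x.
  move: (orbit_visits _ _ _) (orbit_visits _ _ _) le ihm.
  by move: (orbit_visits _ _ _) (orbit_visits _ _ _) => *; nra.
have mean M : s1 * (M%:R - L%:R) <= M%:R * pr A + s1 * (M%:R * pr bad).
  have [ML|LM] := leqP M L.
    apply: (@le_trans _ _ 0).
      by rewrite pmulr_rle0// subr_le0 ler_nat.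
    by rewrite addr_ge0 ?mulr_ge0 ?pr_ge0// ltW.
  pose B (i : bool * 'I_M) := iter i.2 T @^-1` (if i.1 then A else bad).
  pose b (i : bool * 'I_M) := if i.1 then 1 else s1.
  have mB i : measurable (B i).
    by apply: measurable_preimage (measurable_iter _ mT) _; case: i.1.
  have sumE (f : bool * 'I_M -> R) :
      \sum_i f i = \sum_(j < M) f (true, j) + \sum_(j < M) f (false, j).
    rewrite (eq_bigr (fun p => f (p.1, p.2))) => [|[]//].
    by rewrite -(pair_bigA _ (fun i j => f (i, j)))/= big_bool.
  have := @expectation_count_le _ _ _ mu unit _ (fun=> tt)
    (fun=> s1 * (M%:R - L%:R)) B 0 b.
  rewrite sumE (big_pred1 tt) => [|[]//].
  rewrite (_ : _ @^-1` _ = setT); last by apply/seteqP; split.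
  have mtt : @measurable_label _ X unit (fun=> tt).
    by case; rewrite (_ : _ @^-1` _ = setT)//; apply/seteqP; split.
  rewrite prT mul1r add0r/= => le; apply: le_trans (le mtt mB _ _ _ _) _ => //.
  - by move=> _; rewrite mulr_ge0 ?(ltW s10)// subr_ge0 ler_nat ltnW.
  - by move=> [[] j]; rewrite /b ?(ltW s10).
  - move=> x; rewrite sumE add0r /b/=; apply: le_trans (parse M x) _.
    rewrite mulr_sumr /orbit_visits; apply: lerD; apply: ler_sum => j _.
      by rewrite mul1r.
    by [].
  rewrite /b/B/=; apply: lerD.
    rewrite (eq_bigr (fun=> pr A)) => [|j _]; last by rewrite mul1r pr_iter.
    by rewrite sumr_const card_ord -[pr A *+ _]mulr_natl.
  rewrite (eq_bigr (fun=> s1 * pr bad)) => [|j _]; last by rewrite pr_iter.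
  by rewrite sumr_const card_ord -[_ * pr bad *+ _]mulr_natl mulrCA.
pose M := (Num.truncn (2 * s1 * L%:R / (s1 - pr A))).+1.
have : 2 * s1 * L%:R / (s1 - pr A) < M%:R by exact: truncnS_gt.
rewrite ltr_pdivrMr ?subr_gt0//; have := mean M; move: badL.
rewrite ltr_pdivlMr ?mulr_gt0//.
have : 0 <= M%:R :> R by [].
by move: (pr bad) (pr A) (M%:R : R) (L%:R : R) => *; nra.
Qed.

End Ergodic.

(** * Sums over words and renewal laws *)

Section WordSums.
Variables (R : realType) (A : finType).
Implicit Types (F G : seq A -> R) (w : seq A).

(** Recursion on the first letter makes sums over concatenated words split by a
    plain induction ([sumw_cat]); [sum_letters] relates it to sums over finite
    functions. *)
Fixpoint sumw n F : R :=
  if n is n'.+1 then \sum_a sumw n' (fun w => F (a :: w)) else F [::].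

Lemma ler_sumw n F G : (forall w, size w = n -> F w <= G w) ->
  sumw n F <= sumw n G.
Proof.
elim: n F G => [|n ih] F G FG /=; first exact: FG.
by apply: ler_sum => a _; apply: ih => w wn; apply: FG; rewrite /= wn.
Qed.

Lemma eq_sumw n F G : (forall w, size w = n -> F w = G w) ->
  sumw n F = sumw n G.
Proof.
by move=> FG; apply/eqP; rewrite eq_le !ler_sumw// => w /FG->.
Qed.

Lemma sumw_cat m n F :
  sumw (m + n) F = sumw m (fun u => sumw n (fun v => F (u ++ v))).
Proof.
by elim: m F => [//|m ih] F; rewrite addSn /=; apply: eq_bigr => a _; rewrite ih.
Qed.

Lemma sumw_mulr n F k : sumw n (fun w => F w * k) = sumw n F * k.
Proof.
elim: n F => [//|n ih] F /=; rewrite mulr_suml.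
by apply: eq_bigr => a _; rewrite ih.
Qed.

Lemma sumw_mull n F k : sumw n (fun w => k * F w) = k * sumw n F.
Proof. by rewrite mulrC -sumw_mulr; apply: eq_sumw => w _; rewrite mulrC. Qed.

Lemma sumwD n F G : sumw n (fun w => F w + G w) = sumw n F + sumw n G.
Proof.
elim: n F G => [//|n ih] F G /=; rewrite -big_split.
by apply: eq_bigr => a _; rewrite ih.
Qed.

Lemma sumw_sum n M (F : 'I_M -> seq A -> R) :
  sumw n (fun w => \sum_i F i w) = \sum_i sumw n (F i).
Proof.
elim: n F => [//|n ih] F /=; rewrite exchange_big.
by apply: eq_bigr => a _; rewrite ih.
Qed.

Lemma sumw_const n k : sumw n (fun=> k) = #|A|%:R ^+ n * k.
Proof.
elim: n => [|n ih] /=; first by rewrite expr0 mul1r.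
under eq_bigr do rewrite ih.
by rewrite sumr_const -[LHS]mulr_natl exprS mulrA.
Qed.

Definition letters n (w : {ffun 'I_n -> A}) : seq A := [seq w i | i <- enum 'I_n].

Lemma sum_letters n F : \sum_(w : {ffun 'I_n -> A}) F (letters w) = sumw n F.
Proof.
elim: n F => [|n ih] F /=.
  have w0 : {ffun 'I_0 -> A} by apply: finfun => -[].
  rewrite (big_pred1 w0).
    by rewrite /letters (_ : enum 'I_0 = [::])//; apply/size0nil; rewrite size_enum_ord.
  by move=> w /=; apply/esym/eqP/ffunP => -[].
pose h (p : A * {ffun 'I_n -> A}) : {ffun 'I_n.+1 -> A} :=
  [ffun i => oapp p.2 p.1 (unlift ord0 i)].
pose h' (w : {ffun 'I_n.+1 -> A}) : A * {ffun 'I_n -> A} :=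
  (w ord0, [ffun j => w (lift ord0 j)]).
rewrite (reindex h)/=; last first.
  exists h' => [[a w] _|w _].
    rewrite /h' /h ffunE unlift_none/=; congr (_, _).
    by apply/ffunP => j; rewrite !ffunE liftK.
  by apply/ffunP => i; rewrite /h ffunE; case: unliftP => [j ->|->] /=; rewrite ?ffunE.
rewrite (eq_bigr (fun p => F (letters (h (p.1, p.2))))) => [|[]//].
rewrite -(pair_bigA _ (fun a v => F (letters (h (a, v)))))/=.
apply: eq_bigr => a _; rewrite -ih; apply: eq_bigr => w _; congr F.
rewrite /letters enum_ordSl/= ffunE unlift_none/=; congr (_ :: _).
by rewrite -map_comp; apply: eq_map => j /=; rewrite ffunE liftK.
Qed.

(** The total weight of the ways to write w as a concatenation of at most f
    nonempty blocks, each block u having weight b u: if the weights of all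
    blocks add up to at most one, this is a subprobability on the words of any
    given length ([renewal_sum]). *)
Fixpoint renewal (b : seq A -> R) f w : R :=
  (w == [::])%:R +
  if f is f'.+1 then
    \sum_(n < size w) b (take n.+1 w) * renewal b f' (drop n.+1 w)
  else 0.

Variable b : seq A -> R.
Hypothesis b_ge0 : forall u, 0 <= b u.

Lemma renewal_ge0 f w : 0 <= renewal b f w.
Proof.
elim: f w => [|f ih] w /=; first by rewrite addr0.
by rewrite addr_ge0// sumr_ge0// => n _; rewrite mulr_ge0.
Qed.

Lemma renewal_nil f : renewal b f [::] = 1.
Proof. by case: f => [|f] /=; rewrite ?big_ord0 addr0. Qed.

Lemma renewal_cat f u v : (0 < size u)%N ->
  b u * renewal b f v <= renewal b f.+1 (u ++ v).
Proof.
move=> u0 /=.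
have lt : ((size u).-1 < size (u ++ v))%N.
  by rewrite size_cat prednK// leq_addr.
rewrite (bigD1 (Ordinal lt))//= prednK// take_size_cat// drop_size_cat//.
rewrite addrCA lerDl addr_ge0// sumr_ge0// => n _.
by rewrite mulr_ge0// renewal_ge0.
Qed.

Hypothesis b_sum : forall M, \sum_(n < M) sumw n.+1 b <= 1.

Lemma renewal_sum f n : sumw n (renewal b f) <= 1.
Proof.
elim: f n => [|f ih] [|n]; rewrite ?[sumw 0 _]renewal_nil//.
  rewrite [leLHS](_ : _ = sumw n.+1 (fun=> 0)).
    by rewrite sumw_const mulr0.
  by apply: eq_sumw => -[|a w] //= _; rewrite addr0.
apply: le_trans (b_sum n.+1).
rewrite [leLHS](_ : _ = sumw n.+1 (fun w =>
    \sum_(i < n.+1) b (take i.+1 w) * renewal b f (drop i.+1 w))); last first.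
  by apply: eq_sumw => w wn /=; rewrite wn; case: w wn => //= a w _; rewrite add0r.
rewrite sumw_sum; apply: ler_sum => i _.
rewrite -[X in sumw X _](subnKC (ltn_ord i)) sumw_cat.
rewrite (@eq_sumw _ _ (fun u => b u * sumw (n.+1 - i.+1) (renewal b f))).
  rewrite sumw_mulr ler_piMr//.
  rewrite -[leLHS](_ : sumw i.+1 (fun=> 0) = _); last by rewrite sumw_const mulr0.
  exact: ler_sumw.
move=> u ui; rewrite -sumw_mull; apply: eq_sumw => v _.
by rewrite take_size_cat// drop_size_cat.
Qed.

End WordSums.

(** Gibbs' inequality: sum ln t <= t - 1 at t = q w / p w against p. *)
Lemma Gibbs (R : realType) (W : finType) (p q : W -> R) :
  (forall w, 0 <= p w) -> \sum_w p w = 1 ->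
  (forall w, 0 < q w) -> \sum_w q w <= 1 ->
  - \sum_w p w * ln (p w) <= \sum_w p w * - ln (q w).
Proof.
move=> p0 p1 q0 q1.
rewrite -subr_ge0 opprK -big_split/=.
apply: (@le_trans _ _ (\sum_w (p w - q w))).
  by rewrite sumrB p1 subr_ge0.
apply: ler_sum => w _; rewrite mulrN addrC -mulrBr.
have [->|pw0] := eqVneq (p w) 0; first by rewrite mul0r sub0r oppr_le0 ltW.
have {}pw0 : 0 < p w by rewrite lt0r pw0 p0.
rewrite -ln_div ?posrE// -[p w / q w]invrK lnV ?posrE ?invr_gt0 ?divr_gt0//.
rewrite invf_div.
have : ln (q w / p w) <= q w / p w - 1.
  by rewrite -ler_expR lnK ?posrE ?divr_gt0//; apply: le_trans (expR_ge1Dx _); rewrite addrC subrK.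
move=> /(ler_wpM2l (p0 w)); rewrite mulrBr mulrCA divff ?gt_eqF// !mulr1 mulrN => le.
by rewrite -opprB lerN2.
Qed.

(** * The Shannon-McMillan-Breiman theorem *)

Section ShannonMcMillanBreiman.
Context d (X : measurableType d) (R : realType) (mu : probability X R).
Variable T : X -> X.
Hypothesis mT : measurable_fun setT T.
Hypothesis erg : ergodic_measure mu T.
Variables (A : finType) (c : X -> A).
Hypothesis mc : measurable_label c.
Local Notation pr := (real_pr mu).
Local Notation info := (information mu).

Definition word m n (x : X) : {ffun 'I_n -> A} :=
  [ffun i : 'I_n => c (iter (m + i) T x)].

Lemma measurable_word m n : measurable_label (word m n).
Proof. by apply: measurable_label_ffun => i; exact: measurable_label_iter. Qed.
Arguments measurable_word : clear implicits.

Lemma word_shift m n x : word m n x = word 0 n (iter m T x).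
Proof. by apply/ffunP => i; rewrite !ffunE -iterD add0n addnC. Qed.

Definition wordpr n (w : {ffun 'I_n -> A}) : R := pr (word 0 n @^-1` [set w]).

Lemma sum_wordpr n : \sum_(w : {ffun 'I_n -> A}) wordpr w = 1.
Proof. by rewrite pr_label_sum1//; exact: measurable_word. Qed.

Definition entropy_of_words n : R :=
  - \sum_(w : {ffun 'I_n -> A}) wordpr w * ln (wordpr w).

Definition itinerary n x : seq A := [seq c (iter i T x) | i <- iota 0 n].

Lemma letters_word m n x : letters (word m n x) = itinerary n (iter m T x).
Proof.
rewrite word_shift /letters /itinerary -val_enum_ord -map_comp.
by apply: eq_map => i /=; rewrite ffunE.
Qed.

Lemma size_itinerary n x : size (itinerary n x) = n.
Proof. by rewrite size_map size_iota. Qed.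

Lemma itinerary_cat m n x :
  itinerary (m + n) x = itinerary m x ++ itinerary n (iter m T x).
Proof.
rewrite /itinerary iotaD map_cat add0n -[X in iota X n]addn0 iotaDl -map_comp.
by congr (_ ++ _); apply: eq_map => i /=; rewrite -iterD addnC.
Qed.

Definition cylpr (u : seq A) : R :=
  pr [set x | itinerary (size u) x = u].

Lemma cylpr_letters n (w : {ffun 'I_n -> A}) : cylpr (letters w) = wordpr w.
Proof.
have sz : size (letters w) = n by rewrite size_map size_enum_ord.
rewrite /cylpr sz; congr (fine (mu _)); apply/seteqP; split=> x /=.
  rewrite -[x in itinerary _ x]/(iter 0 T x) -letters_word => lw.
  apply/ffunP => i; have /eq_in_map := lw; apply.
  by rewrite mem_enum.
by move=> <-; rewrite letters_word.
Qed.

Lemma cylpr_itinerary n x : cylpr (itinerary n x) = pr (fibre (word 0 n) x).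
Proof. by rewrite -[x in itinerary _ x]/(iter 0 T x) -letters_word cylpr_letters. Qed.

Lemma sumw_cylpr n : sumw n cylpr = 1.
Proof.
by rewrite -sum_letters -(sum_wordpr n); apply: eq_bigr => w _; exact: cylpr_letters.
Qed.

Definition low_information s n := [set x | expR (- (s * n%:R)) <= pr (fibre (word 0 n) x)].

(** Up to the boundary case, the event that the lower limit of the information
    rate is at most s. *)
Definition often_low s := lim_sup_set (low_information s).

Lemma measurable_low_info s n : measurable (low_information s n).
Proof.
exact: (measurable_label_pred (fun w => expR (- (s * n%:R)) <= wordpr w)
  (measurable_word 0 n)).
Qed.

Lemma measurable_often_low s : measurable (often_low s).
Proof. by apply: measurable_lim_sup_set => n; exact: measurable_low_info. Qed.

Lemma often_low_le s s' : s <= s' -> often_low s `<=` often_low s'.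
Proof.
move=> ss' x /lim_sup_setP lx; apply/lim_sup_setP => n.
have [j nj] := lx n; rewrite /low_information/= => le; exists j => //.
by apply: le_trans le; rewrite ler_expR lerN2 ler_wpM2r.
Qed.

(** Dropping the first letter of a word cannot increase its information, and
    changes the length by one only. *)
Lemma often_low_zero_one s s' : s < s' ->
  pr (often_low s) = 0 \/ pr (often_low s') = 1.
Proof.
apply: (zero_one mT erg) => [r|r r' rr']; first exact: measurable_often_low.
split; first by apply: often_low_le; exact: ltW.
move=> x /lim_sup_setP lx; apply/lim_sup_setP => n.
pose N := (Num.truncn (r / (r' - r))).+1.
have [j] := lx (maxn n.+1 N.+1); rewrite geq_max => /andP[nj Nj].
case: j nj Nj => // j nj Nj le; exists j => //=.
have leS : pr (fibre (word 0 j.+1) x) <= pr (fibre (word 0 j) (T x)).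
  rewrite -[leRHS](pr_iter mT erg 1); last exact: measurable_word.
  apply: le_pr; first exact: measurable_word.
    apply: (measurable_preimage (measurable_iter 1 mT)).
    exact: measurable_word.
  move=> y; rewrite /fibre/= => yx; apply/ffunP => i.
  have /ffunP/(_ (lift ord0 i)) := yx.
  by rewrite !ffunE !add0n lift0 !iterSr.
apply: le_trans leS; apply: le_trans le; rewrite ler_expR lerN2 -natr1 mulrDr mulr1.
have : r / (r' - r) < j%:R by apply: lt_le_trans (truncnS_gt _) _; rewrite ler_nat.
rewrite ltr_pdivrMr ?subr_gt0//.
by move: (j%:R : R) => v *; nra.
Qed.

(** With probability 1/2 each, either a word of the process of geometric length
    or a single uniform letter. The geometric parameter costs only e per letter
    of a block, plus a constant that is negligible for long blocks; the uniform
    letters allow to step over points that start no good block. *)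
Definition block e (u : seq A) : R :=
  if size u is n.+1 then
    ((1 - expR (- e)) * expR (- e) ^+ n * cylpr u +
      (n == 0)%N%:R / #|A|%:R) / 2
  else 0.

Lemma block_ge0 e u : 0 < e -> 0 <= block e u.
Proof.
move=> e0; rewrite /block; case: (size u) => // n.
have e1 : expR (- e) <= 1 by rewrite expR_le1 oppr_le0 ltW.
rewrite divr_ge0// addr_ge0 ?divr_ge0// mulr_ge0 ?pr_ge0//.
by rewrite mulr_ge0 ?subr_ge0// exprn_ge0// expR_ge0.
Qed.

Lemma block_sum e M : 0 < e -> \sum_(n < M) sumw n.+1 (block e) <= 1.
Proof.
move=> e0; set r := expR (- e).
have -> : \sum_(n < M) sumw n.+1 (block e) =
    \sum_(n < M) ((1 - r) * r ^+ n + (nat_of_ord n == 0)%N%:R *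
      (#|A|%:R ^+ n.+1 * #|A|%:R^-1)) / 2.
  apply: eq_bigr => n _.
  rewrite (@eq_sumw _ _ _ _ (fun u => ((1 - r) * r ^+ n * cylpr u +
      (nat_of_ord n == 0)%N%:R / #|A|%:R) / 2)); last by move=> u un; rewrite /block un.
  rewrite sumw_mulr sumwD sumw_mull sumw_cylpr mulr1 sumw_const.
  by rewrite [_ ^+ n.+1 * (_ / _)]mulrCA.
rewrite -mulr_suml ler_pdivrMr// mul1r big_split/= -[2]/(1 + 1); apply: lerD.
  by rewrite -mulr_sumr -opprB mulNr -subrX1 opprB gerBl exprn_ge0// expR_ge0.
case: M => [|M]; first by rewrite big_ord0.
rewrite big_ord_recl/= big1 ?addr0 => [|i _]; last by rewrite mul0r.
rewrite mul1r expr1; have [->|A0] := eqVneq (#|A|%:R : R) 0; first by rewrite mul0r.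
by rewrite divff.
Qed.

Lemma alphabet_gt0 (x : X) : 0 < #|A|%:R :> R.
Proof. by rewrite ltr0n; apply/card_gt0P; exists (c x). Qed.

Let C : R := ln (2 * #|A|%:R).

Lemma letter_cost_ge0 (x : X) : 0 <= C.
Proof.
rewrite ln_ge0//; have := alphabet_gt0 x; rewrite ltr0n => A0.
by rewrite -natrM ler1n muln_gt0.
Qed.

Lemma block_letter e a : 0 < e -> expR (- C) <= block e [:: a].
Proof.
move=> e0; have A0 : 0 < #|A|%:R :> R by rewrite ltr0n; apply/card_gt0P; exists a.
rewrite /block/= expRN lnK ?posrE ?mulr_gt0// invfM mulrC.
rewrite ler_pM2r ?invr_gt0// mul1r lerDr expr0 mulr1.
by rewrite mulr_ge0 ?pr_ge0// subr_ge0 expR_le1 oppr_le0 ltW.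
Qed.

Lemma renewal_letters e f w : 0 < e -> (size w <= f)%N ->
  expR (- (C * (size w)%:R)) <= renewal (block e) f w.
Proof.
move=> e0; elim: f w => [|f ih] [|a w] //= wf;
  rewrite ?mulr0 ?oppr0 ?expR0 ?big_ord0 ?addr0//.
have := @renewal_cat _ _ (block e) (fun u => block_ge0 u e0) f [:: a] w isT.
apply: le_trans; rewrite -natr1 mulrDr mulr1 addrC opprD expRD.
by rewrite ler_pM ?expR_ge0// ?block_letter// ih.
Qed.

(** The orbit of x is cut greedily into blocks of bounded length with low
    information; a point of bad starts no such block and costs one letter, as
    do the last L letters. *)
Lemma renewal_itinerary s e n0 L f M x :
  0 <= s -> 0 < e -> (0 < n0)%N ->
  expR (- (e * n0%:R)) <= (1 - expR (- e)) / 2 -> (M <= f)%N ->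
  expR (- ((s + 2 * e) * M%:R +
           C * orbit_visits R T (~` first_time_in (low_information s) n0 L) M x + C * L%:R)) <=
    renewal (block e) f (itinerary M x).
Proof.
move=> s0 e0 n00 n0e; set bad := ~` _; have C0 := letter_cost_ge0 x.
have B0 u := block_ge0 u e0.
elim: f M x => [|f ih] M x Mf.
  move: Mf; rewrite leqn0 => /eqP-> /=; rewrite addr0 expR_le1 oppr_le0.
  by rewrite mulr0 add0r /orbit_visits big_ord0 mulr0 add0r mulr_ge0.
have [ML|LM] := leqP M L.
  have := @renewal_letters e f.+1 (itinerary M x) e0; rewrite size_itinerary.
  move=> /(_ Mf); apply: le_trans; rewrite ler_expR lerN2.
  have : C * M%:R <= C * L%:R by rewrite ler_wpM2l// ler_nat.
  have : 0 <= C * orbit_visits R T bad M x by rewrite mulr_ge0// visits_ge0.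
  have : 0 <= (s + 2 * e) * M%:R by rewrite mulr_ge0// addr_ge0// mulr_ge0// ltW.
  by move=> *; lra.
have [xbad|/contrapT [m /= /andP[n0m mL] le]] := pselect (bad x).
  case: M Mf LM => // M Mf LM.
  rewrite (itinerary_cat 1); apply: le_trans (renewal_cat B0 _ _ _) => //.
  apply: le_trans (ler_pM _ _ (block_letter _ e0) (ih M (T x) _)) => //.
  rewrite -expRD ler_expR visitsS indicE mem_set//= -[M.+1%:R]natr1.
  have : 0 <= s + 2 * e by rewrite addr_ge0// mulr_ge0// ltW.
  by move: (orbit_visits _ _ _ _ _) (M%:R : R) => v m *; nra.
have mM : (m <= M)%N by apply: leq_trans mL (ltnW LM).
have m0 : (0 < m)%N by exact: leq_trans n0m.
rewrite -[M in itinerary M x](subnKC mM) itinerary_cat.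
apply: le_trans (renewal_cat B0 _ _ _); last by rewrite size_itinerary.
have lem : expR (- ((s + 2 * e) * m%:R)) <= block e (itinerary m x).
  rewrite /block size_itinerary cylpr_itinerary; case: m m0 {mL mM} n0m le => // m _ n0m le.
  apply: (@le_trans _ _ ((1 - expR (- e)) / 2 * expR (- e) ^+ m *
      pr (fibre (word 0 m.+1) x))); last first.
    have : 0 <= (m == 0)%N%:R / #|A|%:R :> R by rewrite divr_ge0.
    by move: (_ / #|A|%:R) => v v0; lra.
  have ne : expR (- (e * m.+1%:R)) <= (1 - expR (- e)) / 2.
    apply: le_trans n0e; rewrite ler_expR lerN2 ler_wpM2l ?(ltW e0)//.
    by rewrite ler_nat.
  have me : expR (- (e * m.+1%:R)) <= expR (- e) ^+ m.
    rewrite -expRM_natr ler_expR mulNr lerN2 ler_wpM2l ?(ltW e0)//.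
    by rewrite ler_nat.
  apply: le_trans (ler_pM _ _ (ler_pM _ _ ne me) le); rewrite ?mulr_ge0 ?expR_ge0//.
  by rewrite -!expRD ler_expR; lra.
apply: le_trans (ler_pM _ _ lem (ih (M - m)%N (iter m T x) _)); rewrite ?expR_ge0//; last first.
  by rewrite leq_subLR (leq_trans Mf)// -addn1 addnC leq_add2r.
rewrite -expRD ler_expR -[M in orbit_visits _ _ _ M](subnKC mM) visitsD natrB//.
have := visits_ge0 R T bad m x.
by move: (orbit_visits _ _ _ _ _) (orbit_visits _ _ _ _ _) (m%:R : R) (M%:R : R) => v v' a b *; nra.
Qed.

End ShannonMcMillanBreiman.

Section ShannonMcMillanBreimanLimits.
Context d (X : measurableType d) (R : realType) (mu : probability X R).
Variable T : X -> X.
Hypothesis mT : measurable_fun setT T.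
Hypothesis erg : ergodic_measure mu T.
Variables (A : finType) (c : X -> A).
Hypothesis mc : measurable_label c.
Local Notation pr := (real_pr mu).
Local Notation info := (information mu).
Local Notation evle := (evle mu).
Local Notation word := (word T c).
Local Notation wordpr := (wordpr mu T c).
Local Notation often_low := (often_low mu T c).
Local Notation low_info := (low_information mu T c).
Local Notation word_entropy := (entropy_of_words mu T c).
Local Notation visits := (orbit_visits R T).

Let mword m n : measurable_label (word m n).
Proof. exact: measurable_word. Qed.
Arguments mword : clear implicits.

(** The renewal law with its parameters chosen: n0 so that a block of length at
    least n0 pays for its constant, then L so that the set of points starting no
    good block is negligible compared with the cost D of a letter. *)
Lemma renewal_model s e : 0 <= s -> 0 < e -> pr (often_low s) = 1 ->
  exists (D K : R) (bad : set X) (q : forall n, {ffun 'I_n -> A} -> R),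
  [/\ measurable bad, 0 <= D, 0 <= K & D * pr bad < e] /\
  [/\ forall n w, 0 < q n w, forall n, \sum_w q n w <= 1 &
      forall n x, expR (- ((s + 2 * e) * n%:R + D * visits bad n x + K)) <=
        q n (word 0 n x)].
Proof.
move=> s0 e0 ol1; pose D : R := ln (2 * #|A|%:R).
have D0 : 0 <= D by exact: (letter_cost_ge0 R c point).
have De0 : 0 < e / (D + 1) by rewrite divr_gt0// ltr_wpDl.
have r1 : 0 < 1 - expR (- e) by rewrite subr_gt0 expR_lt1 oppr_lt0.
pose n0 := (Num.truncn (- ln ((1 - expR (- e)) / 2) / e)).+1.
have n0e : expR (- (e * n0%:R)) <= (1 - expR (- e)) / 2.
  rewrite -[leRHS]lnK ?posrE ?divr_gt0// ler_expR lerNl [e * _]mulrC -ler_pdivrMr//.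
  exact: (ltW (truncnS_gt _)).
have mlow n : measurable (low_info s n) by exact: measurable_low_info.
have [L badL] := ae_lim_sup_set_small n0 mlow ol1 De0.
exists D, (D * L%:R), (~` first_time_in (low_info s) n0 L),
  (fun n w => renewal (block mu T c e) n (letters w)).
split; split=> //.
- by apply/measurableC/measurable_first_time_in.
- by rewrite mulr_ge0.
- move: badL; rewrite ltr_pdivlMr ?ltr_wpDl// => badL.
  by apply: le_lt_trans badL; rewrite mulrC ler_wpM2l ?pr_ge0// lerDl.
- move=> n w; have := @renewal_letters _ _ _ mu T _ c e n (letters w) e0.
  rewrite size_map size_enum_ord leqnn => /(_ isT).
  exact/lt_le_trans/expR_gt0.
- move=> n; rewrite (sum_letters n (renewal (block mu T c e) n)).
  apply: renewal_sum; first by move=> u; exact: block_ge0.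
  by move=> M; exact: block_sum.
- by move=> n x; rewrite letters_word; exact: renewal_itinerary.
Qed.

(** Gibbs' inequality with the renewal law, whose cost is integrated. *)
Lemma word_entropy_le s e : 0 <= s -> 0 < e -> pr (often_low s) = 1 ->
  \forall n \near \oo, word_entropy n <= (s + e) * n%:R.
Proof.
move=> s0 e0 ol1; have e40 : 0 < e / 4 by rewrite divr_gt0.
have [D [K [bad [q [[mbad D0 K0 De] [q0 q1 qle]]]]]] := renewal_model s0 e40 ol1.
have le n : word_entropy n <= (s + 2 * (e / 4)) * n%:R + K + n%:R * (D * pr bad).
  apply: le_trans (Gibbs _ _ (q0 n) (q1 n)) _.
  - by move=> w; exact: pr_ge0.
  - exact: sum_wordpr.
  have visitE : \sum_(i < n) D * pr (iter i T @^-1` bad) = n%:R * (D * pr bad).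
    under eq_bigr do rewrite (pr_iter mT erg _ mbad).
    by rewrite sumr_const card_ord -[LHS]mulr_natl.
  have := @expectation_count_le _ _ _ mu _ _ (word 0 n) (fun w => - ln (q n w))
    (fun i : 'I_n => iter i T @^-1` bad) ((s + 2 * (e / 4)) * n%:R + K) (fun=> D) (mword 0 n).
  rewrite visitE; apply => //.
  - by move=> i; exact: (measurable_preimage (measurable_iter _ mT)).
  - move=> w; rewrite oppr_ge0 ln_le0//; apply: le_trans (q1 n).
    by rewrite (bigD1 w)//= lerDl sumr_ge0// => v _; exact/ltW.
  - by rewrite addr_ge0// mulr_ge0// addr_ge0// mulr_ge0// ltW.
  move=> x; rewrite -mulr_sumr lerNl -ler_expR lnK ?posrE//.
  apply: le_trans (qle n x); rewrite ler_expR lerN2 /orbit_visits.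
  by rewrite addrAC.
exists (Num.truncn (4 * K / e)).+1 => // n /= Kn; apply: le_trans (le n) _.
have : 4 * K / e < n%:R by apply: lt_le_trans (truncnS_gt _) _; rewrite ler_nat.
rewrite ltr_pdivrMr//.
have : 0 <= n%:R :> R by [].
by move: (n%:R : R) (pr bad) De => v p *; nra.
Qed.

(** The infimum l of the rates is shown below to be the limit of the normalized
    Shannon entropies of words. *)
Let rates : set R := [set s | 0 <= s /\ pr (often_low s) = 1].
Let l : R := inf rates.

(** Comparison with the uniform law on words shows that l is at most ln #|A|. *)
Let rates_neq0 : rates !=set0.
Proof.
have A0 : 0 < #|A|%:R :> R by exact: (alphabet_gt0 R c point).
have lnA0 : 0 <= ln (#|A|%:R : R) by rewrite ln_ge0// ler1n -(ltr_nat R).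
exists (ln #|A|%:R + 1); split; first by rewrite addr_ge0.
apply/ae_pr1; first exact: measurable_often_low.
have q0 n (w : {ffun 'I_n -> A}) : 0 <= (#|A|%:R ^- n : R).
  by rewrite invr_ge0 exprn_ge0.
have q1 n : \sum_(w : {ffun 'I_n -> A}) (#|A|%:R ^- n : R) <= 1.
  rewrite sumr_const card_ffun card_ord -[_ ^- n *+ _]mulr_natr natrX mulVf//.
  by rewrite expf_neq0// gt_eqF.
have := likelihood_ratio_bound mu ltr01 (mword 0) q0 q1.
apply: filterS => x -[N _ Nx]; apply/lim_sup_setP => n; exists (maxn n N).
  exact: leq_maxl.
have := Nx (maxn n N) (leq_maxr _ _); rewrite /low_information/=.
move: (maxn n N) => m; rewrite mul1r -ler_pdivrMl ?expR_gt0//.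
apply: le_trans; rewrite -expRN.
have -> : #|A|%:R ^- m = expR (- (ln #|A|%:R * m%:R)) :> R.
  by rewrite expRN expRM_natr lnK.
by rewrite -expRD ler_expR; lra.
Qed.

Let rates_lb : has_lbound rates.
Proof. by exists 0 => s []. Qed.

Let l_ge0 : 0 <= l.
Proof. by apply: lb_le_inf => // s []. Qed.

Let often_low_rate s : l < s -> pr (often_low s) = 1.
Proof.
move=> /(inf_lt rates_neq0) [r [r0 r1] rs].
apply/eqP; rewrite eq_le pr_le1/=; last exact: measurable_often_low.
rewrite -r1; apply: le_pr; try exact: measurable_often_low.
exact/often_low_le/ltW.
Qed.

Let often_low_rate0 s : s < l -> pr (often_low s) = 0.
Proof.
move=> sl; have [s0|s0] := ltP s 0.
  rewrite (_ : often_low s = set0) ?pr0//; apply/seteqP; split=> // x.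
  move=> /lim_sup_setP/(_ 1%N)[n n1]; rewrite /low_information/= => le.
  have := pr_le1 mu (measurable_fibre x (mword 0 n)).
  rewrite leNgt => /negP; apply; apply: lt_le_trans le.
  by rewrite expR_gt1 oppr_gt0 pmulr_llt0// ltr0n.
have [|//|r1] := often_low_zero_one mT erg mc (s := s) (s' := (s + l) / 2).
  by lra.
have : l <= (s + l) / 2 by apply: ge_inf => //; split=> //; lra.
by move=> *; exfalso; lra.
Qed.

(** If s < l, a word has information above r n with probability close to one,
    for some r > s; information being nonnegative, its mean is above s n. *)
Let word_entropy_ge s : s < l -> \forall n \near \oo, s * n%:R <= word_entropy n.
Proof.
move=> sl.
have HE n : word_entropy n =
    \sum_(w : {ffun 'I_n -> A}) wordpr w * - ln (wordpr w).
  by rewrite /entropy_of_words -sumrN; apply: eq_bigr => w _; rewrite mulrN.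
have p0 n (w : {ffun 'I_n -> A}) : 0 <= wordpr w by exact: pr_ge0.
have p1 n (w : {ffun 'I_n -> A}) : wordpr w <= 1 by apply: pr_le1; exact: mword.
have t0 n (w : {ffun 'I_n -> A}) : 0 <= wordpr w * - ln (wordpr w).
  by rewrite mulr_ge0// oppr_ge0 ln_le0.
have [s0|s0] := leP s 0.
  apply: nearW => n; rewrite HE; apply: (@le_trans _ _ 0).
    by rewrite mulr_le0_ge0.
  exact: sumr_ge0.
pose r := (s + l) / 2; have sr : s < r by rewrite /r; lra.
have rl : r < l by rewrite /r; lra.
have r0 : 0 < r by exact: lt_trans sr.
have mlow n : measurable (low_info r n) by exact: measurable_low_info.
have mU n : measurable (\bigcup_(k >= n) low_info r k) by apply: bigcup_measurable.
have : mu (\bigcup_(k >= n) low_info r k) @[n --> \oo] --> mu (often_low r).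
  apply: lim_sup_set_cvg => //; apply: le_lt_trans (probability_le1 _ _) (ltry _).
  exact: mU.
rewrite prE ?often_low_rate0//; last exact: measurable_often_low.
have e0 : 0 < 1 - s / r by rewrite subr_gt0 ltr_pdivrMr// mul1r.
move=> /fine_cvgP[_] /cvgrPdist_lt/(_ _ e0)[N _ HN]; exists N => // n /= Nn.
have : pr (low_info r n) < 1 - s / r.
  have := HN n Nn; rewrite /= sub0r normrN => /(le_lt_trans (ler_norm _)).
  apply: le_lt_trans; apply: le_pr => // x lx; exists n => //=.
move=> low; pose P (w : {ffun 'I_n -> A}) := expR (- (r * n%:R)) <= wordpr w.
have lowE : pr (low_info r n) = \sum_(w | P w) wordpr w.
  by rewrite -pr_label_sum//; exact: mword.
have PC : \sum_(w | ~~ P w) wordpr w = 1 - pr (low_info r n).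
  have := sum_wordpr mu mT mc n; rewrite (bigID P)/= -lowE => <-.
  by rewrite [X in _ = X - _]addrC addrK.
apply: (@le_trans _ _ ((1 - pr (low_info r n)) * (r * n%:R))).
  rewrite mulrA ler_wpM2r// -ler_pdivrMr//.
  by lra.
rewrite -PC mulr_suml HE [leRHS](bigID P)/= -[leLHS]add0r; apply: lerD.
  exact: sumr_ge0.
apply: ler_sum => w; rewrite -ltNge => /ltW Pw.
have [->|pw] := eqVneq (wordpr w) 0; first by rewrite !mul0r.
have {}pw : 0 < wordpr w by rewrite lt0r pw p0.
by rewrite ler_wpM2l// lerNr -ler_expR lnK.
Qed.

(** The entropy of T with respect to the partition into fibres of c. *)
Definition process_entropy : R := limn (fun n => word_entropy n / n%:R).
Local Notation rate := process_entropy.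

Let cvg_rate : (fun n => word_entropy n / n%:R) @ \oo --> l.
Proof.
apply/cvgrPdist_le => e e0.
have e20 : 0 < e / 2 by rewrite divr_gt0.
have l1 : pr (often_low (l + e / 2)) = 1 by apply: often_low_rate; rewrite ltrDl.
have le1 := word_entropy_le (addr_ge0 l_ge0 (ltW e20)) e20 l1.
have le2 : \forall n \near \oo, (l - e) * n%:R <= word_entropy n.
  by apply: word_entropy_ge; rewrite gtrBl.
near=> n; have n0 : 0 < n%:R :> R by rewrite ltr0n; near: n; exists 1%N.
rewrite ler_distlC; apply/andP; split.
  by rewrite ler_pdivlMr//; near: n.
rewrite ler_pdivrMr// [X in X * _](_ : _ = l + e / 2 + e / 2); last by lra.
by near: n.
Unshelve. all: by end_near. Qed.

Let rateE : rate = l.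
Proof. exact: (cvg_lim (@Rhausdorff R) cvg_rate). Qed.

Lemma rate_ge0 : 0 <= rate.
Proof. by rewrite rateE. Qed.

Lemma info_word_ge (M : nat -> nat) (K : nat) : (forall n, (M n <= K * n)%N) ->
  evle (fun n _ => rate * (M n)%:R) (fun n x => info (word 0 (M n)) x).
Proof.
move=> MK e e0; rewrite rateE; pose s := l - e / (K%:R + 1).
have K1 : 0 < K%:R + 1 :> R by rewrite ltr_wpDl.
have /often_low_rate0 ol0 : s < l by rewrite gtrBl divr_gt0.
have := pr_negligible (measurable_often_low mu mT mc s) ol0.
have low : mu.-negligible (often_low s) -> {ae mu, forall x, ~ often_low s x}.
  by apply: negligibleS => x /= /contrapT.
move=> /low; move: (ae_fibres_gt0 mu (mword 0)); apply: filterS2 => x pos.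
move=> /lim_sup_setP/existsNP [N Nx].
exists (Num.truncn (l * N%:R / e)).+1 => // n /= nN.
have [MN|NM] := ltnP (M n) N.
  apply: (@le_trans _ _ (e * n%:R)); last by rewrite lerDr info_ge0//; exact: mword.
  apply: (@le_trans _ _ (l * N%:R)); first by rewrite ler_wpM2l// ler_nat ltnW.
  rewrite [e * _]mulrC -ler_pdivrMr//; apply/ltW/(lt_le_trans (truncnS_gt _)).
  by rewrite ler_nat.
have leM : (M n)%:R <= K%:R * n%:R :> R by rewrite -natrM ler_nat.
have low_info_n : s * (M n)%:R <= info (word 0 (M n)) x.
  rewrite lerNr -ler_expR lnK ?posrE ?pos//; apply/ltW; rewrite ltNge.
  by apply/negP => le; apply: Nx; exists (M n).
apply: le_trans (_ : _ <= s * (M n)%:R + e * n%:R) _; last by rewrite lerD2r.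
rewrite /s mulrBl -addrA lerDl addrC subr_ge0 mulrAC ler_pdivrMr//.
rewrite -mulrA ler_pM2l// mulrDr mulr1; apply: le_trans leM _.
by rewrite mulrC lerDl.
Qed.

(** The renewal law bounds the information of the word read in any window. Only
    the visits to bad inside the window matter; they are bounded by those from
    time 0 on, which Birkhoff's theorem controls. *)
Lemma window_info_le (m k : nat -> nat) (K : nat) :
  (0 < K)%N -> (forall n, (m n + k n <= K * n)%N) ->
  evle (fun n x => info (word (m n) (k n)) x) (fun n _ => rate * (k n)%:R).
Proof.
move=> K0 mkK e e0; rewrite rateE.
(* The error adds up to (4 K + 2) g n, see gE below. *)
pose K4 : R := 4 * K%:R + 2.
have K40 : 0 < K4 by rewrite /K4 ltr_wpDl.
pose g := e / (2 * K4); have g0 : 0 < g by rewrite divr_gt0// mulr_gt0.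
have ol1 : pr (often_low (l + g)) = 1 by apply: often_low_rate; rewrite ltrDl.
have [D [Q [bad [q [[mbad D0 Q0 Dbad] [q0 q1 qle]]]]]] :=
  renewal_model (addr_ge0 l_ge0 (ltW g0)) g0 ol1.
have [t [badt t0 Dt]] : exists t : R, [/\ pr bad < t, 0 < t & D * t <= g].
  have [->|D_neq0] := eqVneq D 0.
    by exists (pr bad + 1); split; rewrite ?ltrDl ?ltr_wpDl ?pr_ge0// mul0r ltW.
  have Dpos : 0 < D by rewrite lt0r D_neq0.
  exists (g / D); split.
  - by rewrite ltr_pdivlMr// mulrC.
  - by rewrite divr_gt0.
  - by rewrite mulrCA divff ?mulr1.
have mw n : measurable_label (word (m n) (k n)) by exact: mword.
have := likelihood_ratio_bound mu g0 mw (fun n w => ltW (q0 (k n) w))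
  (fun n => q1 (k n)).
move: (ae_visits_lt mT erg mbad badt) (ae_fibres_gt0 mu mw).
apply: filterS3 => x [N _ vN] pos [N' _ qN].
exists (maxn (maxn N N') (Num.truncn (2 * Q / e)).+1) => // n /=.
rewrite !geq_max => /andP[/andP[nN nN'] nQ].
have : 2 * Q / e < n%:R by apply: lt_le_trans (truncnS_gt _) _; rewrite ler_nat.
rewrite ltr_pdivrMr// => {}nQ.
have {nN} vis : visits bad (k n) (iter (m n) T x) <= t * (K%:R * n%:R).
  have := vN (K * n)%N (leq_trans nN (leq_pmull _ K0)).
  rewrite natrM => /ltW; apply: le_trans.
  rewrite -(subnKC (mkK n)) !visitsD -addrA [leRHS]addrCA lerDl.
  by rewrite addr_ge0// visits_ge0.
have {nN'} := qN n nN'; have := qle (k n) (iter (m n) T x).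
rewrite -word_shift => le1 le2; have {le1 le2} := le_trans le1 le2.
rewrite /information -ler_ln ?posrE ?mulr_gt0 ?expR_gt0 ?pos// lnM ?posrE ?expR_gt0 ?pos//.
rewrite !expRK => le.
have kK : (k n)%:R <= K%:R * n%:R :> R.
  by rewrite -natrM ler_nat (leq_trans _ (mkK n))// leq_addl.
have Dvis : D * visits bad (k n) (iter (m n) T x) <= g * (K%:R * n%:R).
  apply: le_trans (_ : _ <= D * (t * (K%:R * n%:R))) _; first by rewrite ler_wpM2l.
  by rewrite mulrA ler_wpM2r// mulr_ge0.
have gk : g * (k n)%:R <= g * (K%:R * n%:R) by rewrite ler_wpM2l// ltW.
have gE : g * (4 * K%:R + 2) = e / 2.
  by rewrite /g invfM mulrA divfK// gt_eqF.
have gEn : g * (K%:R * n%:R) * 4 + g * n%:R * 2 = e / 2 * n%:R.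
  by rewrite -gE; ring.
have gn : 0 <= g * n%:R by rewrite mulr_ge0// ltW.
move: le Dvis gk gEn gn nQ; move: (visits _ _ _) (ln _) => v i.
move: {Dbad g0 ol1 qle gE qN Dt} g => g; move: (n%:R : R) ((k n)%:R : R) (K%:R : R).
by move=> *; lra.
Qed.

(** The word on [0, m + k) is the pair of the words on [0, m) and [m, m + k), so
    the information of the latter is at least that of the whole word minus that
    of the former. *)
Lemma window_info_ge (m k : nat -> nat) (K : nat) :
  (0 < K)%N -> (forall n, (m n + k n <= K * n)%N) ->
  evle (fun n _ => rate * (k n)%:R) (fun n x => info (word (m n) (k n)) x).
Proof.
move=> K0 mkK.
have mK n : (0 + m n <= K * n)%N by rewrite (leq_trans _ (mkK n))// leq_addr.
have whole := info_word_ge mkK.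
have head := window_info_le K0 mK.
have split := info_pair mu (fun n => mword 0 (m n)) (fun n => mword (m n) (k n)).
move=> e e0; have e30 : 0 < e / 3 by rewrite divr_gt0.
move: (whole _ e30) (head _ e30) (split _ e30).
apply: filterS3 => x; apply: filterS3 => n.
have -> : info (fun y => (word 0 (m n) y, word (m n) (k n) y)) x =
    info (word 0 (m n + k n)) x.
  apply: eq_info; rewrite fibre_pair !(fibre_window (fun t y => c (iter t T y))).
  apply/seteqP; split=> y.
    move=> [h1 h2] t /andP[_]; rewrite add0n => tmk.
    by have [mt|tm] := leqP (m n) t; [apply: h2; rewrite mt|apply: h1].
  move=> h; split=> t /andP[mt tm]; apply: h => //.
  by rewrite add0n (leq_trans tm)// leq_addr.
rewrite natrD mulrDr.
move: (info _ _) (info _ _) (info _ _) (n%:R : R) => *; lra.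
Qed.

End ShannonMcMillanBreimanLimits.

(** * Words mixing several alphabets *)

Section MixedWords.
Context d (X : measurableType d) (R : realType) (mu : probability X R).
Variable T : X -> X.
Hypothesis mT : measurable_fun setT T.
Hypothesis erg : ergodic_measure mu T.
Local Notation pr := (real_pr mu).
Local Notation info := (information mu).
Local Notation evle := (evle mu).
Local Notation word := (word T).
Local Notation rate c := (process_entropy mu T c).

(** Compare the almost sure growth of the informations of long words. *)
Lemma rate_le (A A' : finType) (c : X -> A) (c' : X -> A') :
  measurable_label c -> measurable_label c' ->
  (forall x y, c x = c y -> c' x = c' y) -> rate c' <= rate c.
Proof.
move=> mc mc' cc'; apply: (@evle_const _ _ _ mu).
have le1 n : (n <= 1 * n)%N by rewrite mul1n.
apply: evle_trans (info_word_ge mT erg mc' le1) _.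
apply: (@evle_trans _ _ _ mu (fun n => info (word c 0 n))); last first.
  by apply: (window_info_le mT erg mc (m := fun=> 0%N) (k := id) (K := 1)).
apply: evleW; have := ae_fibres_gt0 mu (measurable_word mT mc 0).
apply: filterS => x pos n; apply: le_info; rewrite ?pos//;
  try exact: measurable_word.
rewrite !(fibre_window (fun t y => _ (iter t T y))) => y h t tn.
exact/cc'/h.
Qed.

(** A chain of coarser and coarser letters c i, the letter c i being read in
    the time window from s i n to s (i + 1) n. *)
Variables (A : finType) (c : nat -> X -> A) (r : nat -> A -> A).
Hypothesis mc : forall i, measurable_label (c i).
Hypothesis cS : forall i x, c i.+1 x = r i (c i x).
Variables (s : nat -> nat -> nat) (K : nat).
Hypothesis K_gt0 : (0 < K)%N.
Hypothesis s0 : forall n, s 0 n = 0%N.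
Hypothesis s_mono : forall i n, (s i n <= s i.+1 n)%N.

Let s_le i j n : (i <= j)%N -> (s i n <= s j n)%N.
Proof.
elim: j => [|j ih]; first by rewrite leqn0 => /eqP->.
by rewrite leq_eqVlt => /predU1P[->//|/ih ij]; exact: leq_trans ij (s_mono _ _).
Qed.

(** The index of the window containing t, all times from s j n on being
    attributed to window j. *)
Definition piece j n t : nat := \sum_(i < j) (s i.+1 n <= t)%N.

Lemma piece_le j n t i : (t < s i.+1 n)%N -> (piece j n t <= i)%N.
Proof.
move=> ti; have [ji|ij] := leqP j i.
  apply: leq_trans ji; rewrite /piece -[leqRHS]card_ord -sum1_card.
  by apply: leq_sum => l _; exact: leq_b1.
rewrite /piece -(subnKC (ltnW ij)) big_split_ord/= [X in (_ + X)%N]big1 ?addn0.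
  rewrite -[leqRHS]card_ord -sum1_card.
  by apply: leq_sum => l _; exact: leq_b1.
move=> l _; apply/eqP; rewrite eqb0 -ltnNge (leq_trans ti)// s_le//.
by rewrite ltnS leq_addr.
Qed.

Let piece_last j n t : (s j n <= t)%N -> piece j n t = j.
Proof.
move=> jt; rewrite /piece -[RHS]card_ord -sum1_card; apply: eq_bigr => i _.
by rewrite (leq_trans _ jt)// s_le.
Qed.

Definition mixed_letter j n t x := c (piece j n t) (iter t T x).

Definition mixed j m n (x : X) : {ffun 'I_m -> A} :=
  [ffun i : 'I_m => mixed_letter j n (0 + i) x].

Lemma measurable_mixed j m n : measurable_label (mixed j m n).
Proof. by apply: measurable_label_ffun => i; exact: measurable_label_iter. Qed.

Definition mixed_rate j m n : R :=
  \sum_(i < j) rate (c i) * (s i.+1 n - s i n)%:R + rate (c j) * (m - s j n)%:R.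

(** The lower bound compares the window of piece j + 1 with the finer letter
    c j: refining the last window of the mixed word for j + 1 gives the mixed
    word for j, and costs at most the difference of the informations of that
    window. *)
Lemma mixed_info (j : nat) (m : nat -> nat) :
  (forall n, s j n <= m n <= K * n)%N ->
  evle (fun n => info (mixed j (m n) n)) (fun n _ => mixed_rate j (m n) n) /\
  evle (fun n _ => mixed_rate j (m n) n) (fun n => info (mixed j (m n) n)).
Proof.
elim: j m => [|j ih] m sm.
  have mK n : (0 + m n <= K * n)%N by have /andP[] := sm n.
  have infoE n x : info (mixed 0 (m n) n) x = info (word (c 0%N) 0 (m n)) x.
    apply: eq_info; rewrite (fibre_window (mixed_letter 0 n)).
    rewrite (fibre_window (fun t y => c 0%N (iter t T y))).
    have p0 t : piece 0 n t = 0%N by rewrite /piece big_ord0.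
    by apply/seteqP; split=> y h t tm; have := h t tm; rewrite /mixed_letter p0.
  have rateE n : mixed_rate 0 (m n) n = rate (c 0%N) * (m n)%:R.
    by rewrite /mixed_rate big_ord0 add0r s0 subn0.
  have := window_info_ge mT erg (mc 0) K_gt0 mK.
  have := window_info_le mT erg (mc 0) K_gt0 mK.
  by move=> le ge; split=> e e0; [move: (le e e0)|move: (ge e e0)];
    apply: filterS => x; apply: filterS => n; rewrite infoE rateE.
pose k n := (m n - s j.+1 n)%N.
have sk n : (s j.+1 n + k n = m n)%N by rewrite subnKC//; have /andP[] := sm n.
have skK n : (s j.+1 n + k n <= K * n)%N by rewrite sk; have /andP[] := sm n.
have [|head_le head_ge] := ih (s j.+1).
  by move=> n; rewrite s_mono/= (leq_trans _ (skK n))// leq_addr.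
have [|whole_le whole_ge] := ih m.
  move=> n; have /andP[sm1 ->] := sm n; rewrite andbT.
  exact: leq_trans (s_mono _ _) sm1.
pose F n := mixed j (s j.+1 n) n.
pose G n := word (c j) (s j.+1 n) (k n).
pose G' n := word (c j.+1) (s j.+1 n) (k n).
have mF n : measurable_label (F n) by exact: measurable_mixed.
have mG n : measurable_label (G n) by exact: measurable_word.
have mG' n : measurable_label (G' n) by exact: measurable_word.
have FG n x : info (fun y => (F n y, G n y)) x = info (mixed j (m n) n) x.
  apply: eq_info; rewrite fibre_pair !(fibre_window (mixed_letter j n)).
  rewrite (fibre_window (fun t y => c j (iter t T y))) sk.
  apply/seteqP; split=> y.
    move=> [h1 h2] t /andP[_ tm]; have [st|ts] := leqP (s j.+1 n) t.
      by rewrite /mixed_letter (piece_last (leq_trans (s_mono j n) st)) h2// st.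
    exact: h1.
  move=> h; split=> t /andP[st tm].
    by apply: h; rewrite add0n (leq_trans tm)// add0n -(sk n) leq_addr.
  have := h t; rewrite /mixed_letter (piece_last (leq_trans (s_mono j n) st)).
  by apply; rewrite add0n.
have FG' n x : info (fun y => (F n y, G' n y)) x = info (mixed j.+1 (m n) n) x.
  have pieceS t : (t < s j.+1 n)%N -> piece j.+1 n t = piece j n t.
    move=> ts; rewrite /piece big_ord_recr/=.
    by rewrite [(s j.+1 n <= t)%N]leqNgt ts addn0.
  apply: eq_info; rewrite fibre_pair !(fibre_window (mixed_letter _ n)).
  rewrite (fibre_window (fun t y => c j.+1 (iter t T y))) sk.
  apply/seteqP; split=> y.
    move=> [h1 h2] t /andP[_ tm]; have [st|ts] := leqP (s j.+1 n) t.
      by rewrite /mixed_letter (piece_last st) h2// st.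
    by rewrite /mixed_letter pieceS//; exact: h1.
  move=> h; split=> t /andP[st tm].
    have := h t; rewrite /mixed_letter pieceS//; apply.
    by rewrite add0n (leq_trans tm)// add0n -(sk n) leq_addr.
  have := h t; rewrite /mixed_letter (piece_last st).
  by apply; rewrite add0n.
have G'E n x : info ((fun w : {ffun 'I_(k n) -> A} => [ffun i => r j (w i)]) \o G n) x
    = info (G' n) x.
  by congr (info _ _); apply/funext => y; apply/ffunP => i; rewrite !ffunE cS.
have headE n : mixed_rate j (s j.+1 n) n = \sum_(i < j.+1) rate (c i) * (s i.+1 n - s i n)%:R.
  by rewrite /mixed_rate big_ord_recr.
have wholeE n : mixed_rate j (m n) n =
    mixed_rate j (s j.+1 n) n + rate (c j) * (k n)%:R.
  rewrite /mixed_rate -addrA -mulrDr -natrD; congr (_ + _ * _%:R).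
  have /andP[sm1 _] := sm n.
  by rewrite addnC /k addnBA// subnK.
have mixedE n : mixed_rate j.+1 (m n) n =
    mixed_rate j (s j.+1 n) n + rate (c j.+1) * (k n)%:R by rewrite headE.
split.
  move=> e e0; have tail_le := window_info_le mT erg (mc j.+1) K_gt0 skK.
  have := evle_trans (info_pair mu mF mG') (evleD head_le tail_le).
  by move=> /(_ e e0); apply: filterS => x; apply: filterS => n; rewrite mixedE FG'.
have refine_le : evle (fun n x => info (mixed j (m n) n) x + info (G' n) x)
    (fun n x => info (mixed j.+1 (m n) n) x + info (G n) x).
  move=> e' e'0.
  have := info_refine mu
    (fun n (w : {ffun 'I_(k n) -> A}) => [ffun i => r j (w i)]) mF mG e'0.
  apply: filterS => x; apply: filterS => n; rewrite FG G'E -FG'.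
  rewrite [X in _ <= X + _ + _](@eq_info _ _ _ _ _ _ _ (fun y => (F n y, G' n y)))//.
  apply/seteqP; split=> y; rewrite /fibre/= => -[-> h]; congr (_, _);
    by apply/ffunP => i; move/ffunP/(_ i): h; rewrite !ffunE !cS.
have sum_ge := evleD whole_ge (window_info_ge mT erg (mc j.+1) K_gt0 skK).
have := evle_trans sum_ge refine_le.
move=> low; have := evleD low (window_info_le mT erg (mc j) K_gt0 skK).
move=> {}low e e0; move: (low e e0); apply: filterS => x; apply: filterS => n.
rewrite wholeE mixedE.
by move: (info _ x) (info _ x) (n%:R : R) (mixed_rate _ _ _) => *; lra.
Qed.

End MixedWords.

(** * Labels on metric spaces *)

Section MetricLabels.
Context d (X : measurableType d) (R : realType) (mu : probability X R).
Variables (Y : pmetricType R) (f : X -> Y).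
Hypothesis mf : forall U : set Y, open U -> measurable (f @^-1` U).
Local Notation pr := (real_pr mu).

Lemma open_mball (x : Y) (e : R) : open [set y | mdist x y < e].
Proof.
rewrite openE => y /= xy; apply/nbhs_ballP; exists (e - mdist x y) => /=.
  by rewrite subr_gt0.
move=> z; rewrite ballEmdist/= => yz.
by apply: le_lt_trans (metric_triangle x y z) _; rewrite -ltrBrDl.
Qed.

(** Lusin's property for a set, in the quantitative form used below: away from
    a small exceptional set Z, membership of x in V is decided by any point y
    close to x through a fixed measurable set V'. *)
Definition stable_set (V : set Y) : Prop := measurable (f @^-1` V) /\
  forall g : R, 0 < g -> exists (e : R) (V' Z : set Y),
    [/\ 0 < e, measurable (f @^-1` V'), measurable (f @^-1` Z),
        pr (f @^-1` Z) < g &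
        forall x y, ~ Z x -> mdist x y < e -> V' y <-> V x].

(** Shrinking an open set by a small distance removes a set of small measure. *)
Lemma open_stable (U : set Y) : open U -> stable_set U.
Proof.
move=> oU; split; first exact: mf.
move=> g g0.
pose B e := [set y | exists2 x, ~ U x & mdist x y < e].
have oB e : open (B e).
  rewrite (_ : B e = \bigcup_(x in ~` U) [set y | mdist x y < e]).
    by apply: bigcup_open => x _; exact: open_mball.
  by apply/seteqP; split=> [y [x]|y [x]]; exists x.
have mB e : measurable (f @^-1` B e) by exact/mf/oB.
pose e n : R := n.+1%:R^-1.
have e0 n : 0 < e n by rewrite invr_gt0.
pose Z n := f @^-1` (U `&` B (e n)).
have mZ n : measurable (Z n).
  by rewrite /Z preimage_setI; apply: measurableI => //; exact: mf.
have Z0 : \bigcap_n Z n = set0.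
  apply/seteqP; split=> // x Zx.
  have [Ux _] := Zx 0%N I.
  have [r /= r0 rU] : nbhs_ball (f x) U.
    by apply/nbhs_ballP; move: Ux; rewrite openE in oU; exact: oU.
  have [_ [z nz]] := Zx (Num.truncn r^-1) I.
  rewrite metric_sym => zx; apply: nz; apply: rU.
  rewrite ballEmdist/=; apply: lt_trans zx _.
  by rewrite /e invf_plt ?posrE// truncnS_gt.
have : mu \o Z @ \oo --> mu (\bigcap_n Z n).
  apply: nonincreasing_cvg_mu => //.
  - by apply: le_lt_trans (probability_le1 _ _) (ltry _).
  - exact: bigcap_measurable.
  move=> n m nm; apply/subsetPset => x [Ux [z nz zx]]; split=> //.
  exists z => //; apply: lt_le_trans zx _.
  by rewrite lef_pV2 ?posrE// ler_nat.
rewrite Z0 measure0 => /fine_cvgP[_] /cvgrPdist_lt/(_ _ g0)[N _ /(_ N (leqnn N))].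
rewrite /= sub0r normrN => /(le_lt_trans (ler_norm _)) ZN.
exists (e N / 2), (~` B (e N / 2)), (U `&` B (e N)); split=> //.
- by rewrite divr_gt0.
- by rewrite preimage_setC; exact/measurableC/mB.
- exact: (mZ N).
move=> x y nZ xy; split.
  move=> nB; apply: contrapT => nU; apply: nB; exists x => //.
move=> Ux [z nz zy]; apply: nZ; split=> //; exists z => //.
apply: le_lt_trans (metric_triangle z y x) _.
by rewrite (splitr (e N)) ltrD// metric_sym.
Qed.

Lemma stable_set0 : stable_set set0.
Proof.
split; first by rewrite preimage_set0.
move=> g g0; exists 1, set0, set0; split; rewrite ?preimage_set0//.
by rewrite pr0.
Qed.

Lemma stable_setU (V W : set Y) :
  stable_set V -> stable_set W -> stable_set (V `|` W).
Proof.
move=> [mV sV] [mW sW]; split; first by rewrite preimage_setU; exact: measurableU.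
move=> g g0; have g20 : 0 < g / 2 by rewrite divr_gt0.
have [e [V' [Z [e0 mV' mZ Zg VV']]]] := sV _ g20.
have [h [W' [Z' [h0 mW' mZ' Z'g WW']]]] := sW _ g20.
exists (Num.min e h), (V' `|` W'), (Z `|` Z'); split.
- by rewrite lt_min e0.
- by rewrite preimage_setU; exact: measurableU.
- by rewrite preimage_setU; exact: measurableU.
- rewrite preimage_setU; apply: le_lt_trans (prU_le _ _ _) _ => //.
  by rewrite (splitr g) ltrD.
move=> x y nZ; rewrite lt_min => /andP[xye xyh].
have [nZ1 nZ2] : ~ Z x /\ ~ Z' x by split=> Zx; apply: nZ; [left|right].
by rewrite /setU/= (VV' _ _ nZ1 xye) (WW' _ _ nZ2 xyh).
Qed.

(** A countable union is a finite union up to a set of small measure. *)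
Lemma stable_sigma_algebra : sigma_algebra setT stable_set.
Proof.
split.
- exact: stable_set0.
- move=> V [mV sV]; rewrite setTD; split.
    by rewrite preimage_setC; exact: measurableC.
  move=> g /sV [e [V' [Z [e0 mV' mZ Zg VV']]]].
  exists e, (~` V'), Z; split=> //; first by rewrite preimage_setC; exact: measurableC.
  by move=> x y nZ xy; rewrite /= (VV' x y).
move=> V sV.
have mV n : measurable (f @^-1` V n) by exact: (sV n).1.
have mU : measurable (f @^-1` (\bigcup_n V n)).
  by rewrite preimage_bigcup; exact: bigcup_measurable.
split=> // g g0.
pose U n := \bigcup_(i < n) V i; pose D n := f @^-1` U n.
have sU n : stable_set (U n).
  elim: n => [|n ih]; first by rewrite /U bigcup_mkord big_ord0; exact: stable_set0.
  rewrite /U bigcup_mkord big_ord_recr -bigcup_mkord.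
  exact: stable_setU.
have mD n : measurable (D n) by exact: (sU n).1.
have DU : \bigcup_n D n = f @^-1` (\bigcup_n V n).
  apply/seteqP; split=> x; first by move=> [n _ [i _ Vi]]; exists i.
  by move=> [i _ Vi]; exists i.+1 => //; exists i => /=.
have g20 : 0 < g / 2 by rewrite divr_gt0.
have : mu \o D @ \oo --> mu (\bigcup_n D n).
  apply: nondecreasing_cvg_mu => //; first by rewrite DU.
  move=> n m nm; apply/subsetPset => x [i /= ltin Vi]; exists i => //=.
  exact: leq_trans nm.
rewrite DU prE// => /fine_cvgP[_] /cvgrPdist_lt/(_ _ g20)[N _ /(_ N (leqnn N))].
rewrite /= -/(pr (D N)) => DN.
have [e [V' [Z [e0 mV' mZ Zg VV']]]] := (sU N).2 _ g20.
pose Q := (\bigcup_n V n) `\` U N.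
have mQ : measurable (f @^-1` Q) by exact: (measurableD mU (mD N)).
have prQ : pr (f @^-1` Q) < g / 2.
  apply: le_lt_trans DN; apply: le_trans (ler_norm _).
  rewrite lerBrDr; apply: le_trans (_ : pr (f @^-1` Q `|` D N) <= _).
    rewrite -lee_fin EFinD -!prE//; last exact: measurableU.
    rewrite measureU//; apply/seteqP; split=> // x [[_ nU]]; exact: nU.
  apply: le_pr => //; first exact: measurableU.
  by move=> x [[]//|]; rewrite -DU => Dx; exists N.
exists e, V', (Z `|` Q); split=> //.
- by rewrite preimage_setU; exact: measurableU.
- rewrite preimage_setU; apply: le_lt_trans (prU_le _ _ _) _ => //.
  by rewrite (splitr g) ltrD.
move=> x y nZ xy; have [nZ1 nQ] : ~ Z x /\ ~ Q x.
  by split=> Zx; apply: nZ; [left|right].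
rewrite (VV' x y nZ1 xy); split=> [[i _ Vi]|Vx]; first by exists i.
by apply: contrapT => nU; apply: nQ.
Qed.

Lemma borel_stable (V : set (borel Y)) : measurable V -> stable_set V.
Proof.
apply: smallest_sub; first exact: stable_sigma_algebra.
by move=> U oU; exact: open_stable.
Qed.

(** Lusin's theorem for a function into a finite set: intersect the stability
    of its finitely many fibres. *)
Lemma stable_label (A : finType) (c : borel Y -> A) (g : R) :
  measurable_label c -> 0 < g -> exists (e : R) (h : Y -> A) (Z : set Y),
    [/\ 0 < e, measurable_label (h \o f), measurable (f @^-1` Z),
        pr (f @^-1` Z) < g &
        forall x y, ~ Z x -> mdist x y < e -> h y = c x].
Proof.
move=> mc g0.
have gA0 : 0 < g / (#|A|%:R + 1) by rewrite divr_gt0// ltr_wpDl.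
have /choice[e /choice[V /choice[Z HV]]] : forall a, exists (e : R) (V' Z : set Y),
    [/\ 0 < e, measurable (f @^-1` V'), measurable (f @^-1` Z),
        pr (f @^-1` Z) < g / (#|A|%:R + 1) &
        forall x y, ~ Z x -> mdist x y < e -> V' y <-> (c @^-1` [set a]) x].
  by move=> a; exact: (borel_stable (mc a)).2.
pose h y := odflt (c point) [pick a | y \in V a].
pose w (x : X) := [ffun a => x \in f @^-1` V a].
have mw : measurable_label w.
  by apply: measurable_label_ffun => a; apply: measurable_label_bool; case: (HV a).
exists (\big[Num.min/1]_a e a), h, (\bigcup_a Z a); split.
- by apply: lt_bigmin => // a _; case: (HV a).
- rewrite (_ : h \o f = (fun v : {ffun A -> bool} => odflt (c point) [pick a | v a]) \o w).
    exact: measurable_label_comp.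
  apply/funext => x /=; rewrite /h; congr odflt; apply: eq_pick => a.
  by rewrite ffunE; apply/idP/idP; rewrite !inE.
- rewrite preimage_bigcup; apply: fin_bigcup_measurable; first exact: finite_finset.
  by move=> a _; case: (HV a).
- rewrite preimage_bigcup.
  have mZ a : measurable (f @^-1` Z a) by case: (HV a).
  apply: le_lt_trans (pr_bigcup_le mu mZ) _.
  apply: (@le_lt_trans _ _ (\sum_(a : A) g / (#|A|%:R + 1))).
    by apply: ler_sum => a _; case: (HV a) => _ _ _ /ltW.
  rewrite sumr_const -[X in X < _]mulr_natr mulrAC ltr_pdivrMr ?ltr_wpDl//.
  by rewrite mulrDr mulr1 ltrDl.
move=> x y nZ xy.
have Va a : V a y <-> c x = a.
  have [_ _ _ _] := HV a; apply; first by move=> Zx; apply: nZ; exists a.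
  by apply: lt_le_trans xy _; exact: bigmin_le.
rewrite /h; case: pickP => [a|/(_ (c x))]; first by rewrite inE => /Va.
by rewrite mem_set//; apply/Va.
Qed.

(** Label a point by the first ball containing it, in a finite cover by balls
    of radius e / 2. *)
Lemma small_label (e : R) : compact [set: Y] -> 0 < e ->
  exists (N : nat) (c : borel Y -> 'I_N.+1), measurable_label c /\
    forall x y : Y, c x = c y -> mdist x y < e.
Proof.
rewrite compact_cover => cY e0; have e20 : 0 < e / 2 by rewrite divr_gt0.
pose B (z : Y) := [set y | mdist z y < e / 2].
have [||D _ cov] := cY Y setT B.
- by move=> z _; exact: open_mball.
- by move=> y _; exists y; rewrite // /B/= mdistxx.
pose s : seq Y := finmap.enum_fset D.
pose c (y : Y) : nat := find (fun z => mdist z y < e / 2) s.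
have cP y : has (fun z => mdist z y < e / 2) s.
  by have [z /= zD zy] := cov y I; apply/hasP; exists z.
have mB z : measurable (B z : set (borel Y)).
  by apply: sub_sigma_algebra; exact: open_mball.
exists (size s), (fun y => inord (c y)); split.
  pose w (y : borel Y) := [ffun i : 'I_(size s) => y \in B (nth point s i)].
  have mw : measurable_label w.
    by apply: measurable_label_ffun => i; exact: measurable_label_bool.
  pose r (v : {ffun 'I_(size s) -> bool}) : 'I_(size s).+1 :=
    inord (find id [seq v i | i <- enum 'I_(size s)]).
  rewrite (_ : (fun _ => _) = r \o w); first exact: measurable_label_comp.
  have sE : s = [seq nth point s (val i) | i <- enum 'I_(size s)].
    by rewrite (map_comp (nth point s)) val_enum_ord; exact/esym/mkseq_nth.
  apply/funext => y; rewrite /r /w /= /c [X in find _ X]sE !find_map; congr inord.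
  apply: eq_find => i /=; rewrite ffunE.
  by apply/idP/idP; rewrite inE.
move=> x y cxy.
have {}cxy : c x = c y.
  have cs z : (c z < (size s).+1)%N by rewrite ltnS find_size.
  by rewrite -(inordK (cs x)) -(inordK (cs y)) cxy.
have xz := nth_find point (cP x); have yz := nth_find point (cP y).
rewrite -/(c x) in xz; rewrite -/(c y) -cxy in yz.
apply: le_lt_trans (metric_triangle x (nth point s (c x)) y) _.
by rewrite (splitr e) ltrD// metric_sym.
Qed.

End MetricLabels.

(** * Towers of factors *)

Section BorelMaps.
Variable R : realType.

Lemma continuous_borel (Y Z : pmetricType R) (f : Y -> Z) :
  continuous f -> measurable_fun setT (f : borel Y -> borel Z).
Proof.
move=> /continuousP cf.
apply: (@measurability _ _ (borel Y) (borel Z) setT f (@open Z)) => //.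
by move=> _ [U oU <-]; rewrite setTI; apply: sub_sigma_algebra; exact: cf.
Qed.

Lemma continuous_open_preimage (Y Z : pmetricType R) (f : Y -> Z) (U : set Z) :
  continuous f -> open U -> measurable (f @^-1` U : set (borel Y)).
Proof. by move=> /continuousP cf oU; apply: sub_sigma_algebra; exact: cf. Qed.

Lemma measurable_label_continuous (W : Type) (Y Z : pmetricType R) (f : Y -> Z)
    (b : borel Z -> W) : continuous f -> measurable_label b ->
  measurable_label (b \o f : borel Y -> W).
Proof.
move=> cf mb w; have := continuous_borel cf measurableT (mb w).
by rewrite setTI.
Qed.

End BorelMaps.

Section FactorTowers.
Variables (R : realType) (k : nat) (X : nat -> pmetricType R).
Variables (T : forall i, X i -> X i) (p : forall i, X i -> X i.+1).
Arguments T : clear implicits.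
Arguments p : clear implicits.
Hypothesis hT : forall i, (i < k)%N -> topological_dynamical_system (T i).
Hypothesis hp : forall i, (i.+1 < k)%N -> factor_map (T i) (T i.+1) (p i).

(** The composite map from X i to X (m + i); with the addends in this order the
    types of the recursion agree by computation. *)
Fixpoint tau_from i m : X i -> X (m + i)%N :=
  match m return X i -> X (m + i)%N with
  | 0 => fun x => x
  | m'.+1 => fun x => p (m' + i)%N (@tau_from i m' x)
  end.
Arguments tau_from : clear implicits.

Lemma tau_fromE i m x : tau_from i m (tau p i x) = tau p (m + i)%N x.
Proof. by elim: m => [//|m ih] /=; rewrite ih. Qed.

Lemma continuous_tau_from i m : (m + i < k)%N -> continuous (tau_from i m).
Proof.
elim: m => [|m ih] mk /=; first by move=> x; exact: cvg_id.
move=> x; apply: continuous_comp; first exact/ih/ltnW.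
by have [cp _ _] := hp mk; exact: cp.
Qed.

Lemma continuous_tau i : (i < k)%N -> continuous (tau p i).
Proof.
elim: i => [|i ih] ik /=; first by move=> x; exact: cvg_id.
move=> x; apply: continuous_comp; first exact/ih/ltnW.
by have [cp _ _] := hp ik; exact: cp.
Qed.

Lemma tau_iter i t x : (i < k)%N ->
  tau p i (iter t (T 0%N) x) = iter t (T i) (tau p i x).
Proof.
move=> ik; elim: t => [//|t ih]; rewrite !iterS -ih; move: (iter t _ x) => {ih}x.
elim: i ik x => [//|i ih] ik x /=; rewrite ih ?(ltnW ik)//.
have [_ _ pT] := hp ik.
exact: (congr1 (fun f => f (tau p i x)) pT).
Qed.

Hypothesis k_gt0 : (0 < k)%N.
Variable mu : probability (borel (X 0%N)) R.
Hypothesis hmu : ergodic_measure mu (T 0%N).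

Local Notation T0 := (T 0%N : borel (X 0%N) -> borel (X 0%N)).
Local Notation push i := (pushforward mu (tau p i : borel (X 0%N) -> borel (X i))).
Local Notation rate c := (process_entropy mu T0 c).

Lemma measurable_T0 : measurable_fun setT T0.
Proof. by apply: continuous_borel; have [_] := hT k_gt0. Qed.

(** The factor map transports the itineraries of T i to those of T 0. *)
Lemma entropy_rate (A : finType) i (b : X i -> A) : (i < k)%N ->
  entropy_wrt_partition (push i) (T i) (fun v => b @^-1` [set v]) =
  rate (b \o tau p i).
Proof.
move=> ik; rewrite /entropy_wrt_partition /process_entropy; congr (limn _).
apply/funext => n; congr (_ / _); rewrite /partition_entropy /entropy_of_words.
congr (- _); apply: eq_bigr => w _.
suff -> : fine (push i (dynamical_join (T i) (fun v => b @^-1` [set v]) w)) =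
  wordpr mu T0 (b \o tau p i) w by [].
congr (fine (mu _)); apply/seteqP; split=> x.
  move=> h; apply/ffunP => j; rewrite ffunE add0n /= tau_iter//.
  exact: h.
move=> /ffunP h j _; have := h j; rewrite ffunE add0n /= tau_iter//.
Qed.

Lemma label_of_partition d (Y : measurableType d) N (xi : 'I_N -> set Y) :
  measurable_partition xi ->
  exists2 b : Y -> 'I_N, measurable_label b & xi = (fun v => b @^-1` [set v]).
Proof.
move=> [mxi txi cxi].
have /choice[b xib] : forall y, exists v, xi v y.
  move=> y; have : (\bigcup_i xi i) y by rewrite cxi.
  by move=> [v _ xvy]; exists v.
have E : xi = (fun v => b @^-1` [set v]).
  apply/funext => v; apply/seteqP; split=> y /= => [xvy|<-]; last exact: xib.
  by apply: (txi (b y) v) => //; exists y.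
by exists b => // v; have := mxi v; rewrite E.
Qed.

Lemma measurable_partition_fibres d (Y : measurableType d) N (b : Y -> 'I_N) :
  measurable_label b -> measurable_partition (fun v => b @^-1` [set v]).
Proof.
move=> mb; split=> //; first by move=> v w _ _ [y [/= <- <-]].
by apply/seteqP; split=> // y _; exists (b y).
Qed.

Lemma rate_le_entropy (A : finType) i (b : borel (X i) -> A) : (i < k)%N ->
  measurable_label b ->
  ((rate (b \o tau p i))%:E <= measure_entropy (push i) (T i))%E.
Proof.
move=> ik mb; pose b' := enum_rank \o b.
have mb' : measurable_label b' by exact: measurable_label_comp.
have ctau := continuous_tau ik.
apply: (@le_trans _ _ (rate (b' \o tau p i))%:E).
  rewrite lee_fin; apply: (rate_le measurable_T0 hmu).
  - exact: (measurable_label_continuous ctau).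
  - exact: (measurable_label_continuous ctau).
  by move=> x y /enum_rank_inj.
apply: ereal_sup_ubound; exists #|A|, (fun v => b' @^-1` [set v]).
by split; [exact: measurable_partition_fibres|rewrite entropy_rate].
Qed.

Lemma entropy_ge0 i : (i < k)%N -> (0 <= measure_entropy (push i) (T i))%E.
Proof.
move=> ik; have mtt : measurable_label (fun _ : borel (X i) => tt).
  exact: measurable_label_cst.
apply: le_trans (rate_le_entropy ik mtt).
rewrite lee_fin; apply: (rate_ge0 measurable_T0 hmu).
exact: (measurable_label_continuous (continuous_tau ik) mtt).
Qed.

End FactorTowers.

(** * Weighted Bowen balls *)

Section WeightedChains.
Variables (R : realType) (k : nat) (X : nat -> pmetricType R).
Variables (T : forall i, X i -> X i) (p : forall i, X i -> X i.+1).
Arguments T : clear implicits.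
Arguments p : clear implicits.
Hypothesis hT : forall i, (i < k)%N -> topological_dynamical_system (T i).
Hypothesis hp : forall i, (i.+1 < k)%N -> factor_map (T i) (T i.+1) (p i).
Hypothesis k_gt0 : (0 < k)%N.
Variable mu : probability (borel (X 0%N)) R.
Hypothesis hmu : ergodic_measure mu (T 0%N).
Variable a : nat -> R.
Hypothesis a_ge0 : forall i, (i < k)%N -> 0 <= a i.

Local Notation T0 := (T 0%N : borel (X 0%N) -> borel (X 0%N)).
Local Notation push i := (pushforward mu (tau p i : borel (X 0%N) -> borel (X i))).
Local Notation rate c := (process_entropy mu T0 c).
Local Notation pr := (real_pr mu).
Local Notation info := (information mu).
Local Notation evle := (evle mu).
Local Notation ball n x eps := (weighted_Bowen_ball k T p a n x eps).

Let mT0 : measurable_fun setT T0.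
Proof. exact: (measurable_T0 hT k_gt0). Qed.

Let ctau i : (i < k)%N -> continuous (tau p i).
Proof. exact: (continuous_tau hp). Qed.

Let partial_sum i : R := \sum_(l < i.+1) a l.

Let partial_sum_ge0 i : (i < k)%N -> 0 <= partial_sum i.
Proof.
move=> ik; apply: sumr_ge0 => l _; apply: a_ge0.
exact: leq_trans (ltn_ord l) ik.
Qed.

(** The number of times at which the Bowen ball controls the system X i. *)
Definition duration i n : nat := absz (Num.ceil (partial_sum i * n%:R)).

Let durationE i n : (i < k)%N -> (duration i n)%:Z = Num.ceil (partial_sum i * n%:R).
Proof.
move=> ik; rewrite /duration gez0_abs// -(ler0z R).
apply: le_trans (ceil_ge _); by rewrite mulr_ge0 ?partial_sum_ge0.
Qed.

Let durationR i n : (i < k)%N ->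
  (duration i n)%:R = (Num.ceil (partial_sum i * n%:R))%:~R :> R.
Proof. by move=> ik; rewrite -durationE. Qed.

Let duration_ge i n : (i < k)%N -> partial_sum i * n%:R <= (duration i n)%:R.
Proof. by move=> ik; rewrite durationR// ceil_ge. Qed.

Let duration_lt i n : (i < k)%N -> (duration i n)%:R < partial_sum i * n%:R + 1.
Proof. by move=> ik; rewrite durationR// -ltrBlDr -(intrB _ _ 1) ceilB1_lt. Qed.

Let duration_mono i n : (i.+1 < k)%N -> (duration i n <= duration i.+1 n)%N.
Proof.
move=> ik; rewrite -lez_nat !durationE//; last exact: ltnW.
apply: le_ceil; rewrite ler_wpM2r// /partial_sum [leRHS]big_ord_recr/= lerDl.
exact: a_ge0.
Qed.

(** The start of window i; the minimum keeps the sequence nondecreasing beyond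
    the last system, where nothing is assumed on the weights. *)
Definition cut i n : nat :=
  if i is i'.+1 then duration (minn i' k.-1) n else 0%N.

Let cutS i n : (i < k)%N -> cut i.+1 n = duration i n.
Proof.
move=> ik; rewrite /cut; have -> : minn i k.-1 = i; last by [].
by apply/minn_idPl; rewrite -ltnS prednK.
Qed.

Let cut_mono i n : (cut i n <= cut i.+1 n)%N.
Proof.
case: i => [//|i]; rewrite /cut; have [ik|] := boolP (i < k.-1)%N.
  have -> : minn i k.-1 = i by exact/minn_idPl/ltnW.
  have -> : minn i.+1 k.-1 = i.+1 by exact/minn_idPl.
  by apply: duration_mono; rewrite -ltnS prednK in ik.
rewrite -leqNgt => ki; have -> : minn i k.-1 = k.-1 by exact/minn_idPr.
by have -> : minn i.+1 k.-1 = k.-1 by exact/minn_idPr/ltnW.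
Qed.

Let cut_le i j n : (i <= j)%N -> (cut i n <= cut j n)%N.
Proof.
by apply: (homo_leq (f := cut^~ n) (r := leq)) => //; exact: leq_trans.
Qed.

Let total n : nat := cut k n.

Let totalE n : total n = duration k.-1 n.
Proof. by rewrite /total -[in LHS](prednK k_gt0) cutS// prednK. Qed.

Let K : nat := (Num.truncn (partial_sum k.-1)).+1.

Let k1 : (k.-1 < k)%N. Proof. by rewrite prednK. Qed.

Let total_le n : (total n <= K * n)%N.
Proof.
rewrite totalE -lez_nat durationE// ceil_le_int.
rewrite -[_%:~R]/((K * n)%:R) natrM ler_wpM2r//; apply/ltW; exact: truncnS_gt.
Qed.

(** All conditions pulled back to the single system X 0. *)
Lemma ballE n x eps : ball n x eps =
  [set y | forall i j, (i < k)%N -> (j < cut i.+1 n)%N ->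
    mdist (tau p i (iter j T0 x)) (tau p i (iter j T0 y)) < eps].
Proof.
have jE i j : (i < k)%N ->
    (j%:Z <= Num.ceil ((\sum_(l < i.+1) a l) * n%:R) - 1) = (j < cut i.+1 n)%N.
  move=> ik; rewrite cutS// -/(partial_sum i) -durationE//.
  by rewrite lerBrDr -PoszD addn1 lez_nat.
apply/seteqP; split=> y By i j ik; have := By i j ik.
  by rewrite jE// !(tau_iter hp).
by rewrite jE// !(tau_iter hp).
Qed.

Lemma measurable_ball n x eps : measurable (ball n x eps : set (borel (X 0%N))).
Proof.
rewrite ballE (_ : [set y | _] = \bigcap_(i in [set i | i < k]%N)
  \bigcap_(j in [set j | j < cut i.+1 n]%N) (iter j T0 @^-1`
    (tau p i @^-1` [set z | mdist (tau p i (iter j T0 x)) z < eps]))).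
  apply: bigcap_measurableType => i /= ik; apply: bigcap_measurableType => j _.
  apply: (measurable_preimage (measurable_iter j mT0)).
  by apply: continuous_open_preimage; [exact: ctau|exact: open_mball].
by apply/seteqP; split=> y By i => [ik j jc|j ik jc]; exact: By.
Qed.

Variables (N : nat -> nat) (b : forall i, borel (X i) -> 'I_(N i).+1).
Arguments b : clear implicits.
Hypothesis mb : forall i, (i < k)%N -> measurable_label (b i).

Let Nmax := \max_(i < k) N i.
Let A : finType := {ffun 'I_k -> 'I_Nmax.+1}.

Let N_le i : (i < k)%N -> (N i <= Nmax)%N.
Proof. by move=> ik; exact: (leq_bigmax (Ordinal ik)). Qed.

(** The labels of X i and of all further factors, so that the letter at level i
    determines the one at level i + 1. The default ord0 fills the other places,
    which keeps one alphabet for all levels. *)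
Definition chain_letter (v : forall i, X i -> nat) i (x : X 0%N) : A :=
  [ffun j : 'I_k => if (i <= j)%N then inord (v j (tau p j x)) else ord0].

Let letter i : borel (X 0%N) -> A := chain_letter (fun i z => b i z) i.

Let letterE i (j : 'I_k) x : (i <= j)%N -> letter i x j = inord (b j (tau p j x)).
Proof. by move=> ij; rewrite ffunE ij. Qed.

Let letter_inj i (j : 'I_k) x y : (i <= j)%N -> letter i x j = letter i y j ->
  b j (tau p j x) = b j (tau p j y).
Proof.
have lt z : (b j z < Nmax.+1)%N by apply: leq_trans (ltn_ord _) _; rewrite ltnS N_le.
move=> ij; rewrite !letterE// => /(congr1 (@nat_of_ord _)).
by rewrite !inordK//; exact: ord_inj.
Qed.

Let mletter i : measurable_label (letter i).
Proof.
apply: measurable_label_ffun => j; have jk := ltn_ord j.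
have [ij|_] := leqP i j; last first.
  exact: measurable_label_cst.
pose r (v : 'I_(N j).+1) : 'I_Nmax.+1 := inord v.
apply: (measurable_label_comp r (F := fun x : borel (X 0%N) => b j (tau p j x))).
exact: (measurable_label_continuous (ctau jk) (mb jk)).
Qed.


Let trunc i (w : A) : A := [ffun j : 'I_k => if (i < j)%N then w j else ord0].

Let letterS i x : letter i.+1 x = trunc i (letter i x).
Proof.
apply/ffunP => j; rewrite !ffunE; have [ij|//] := ltnP i j.
by rewrite (ltnW ij).
Qed.

(** The letter at level i is a function of the point of X i. *)
Lemma chain_rate_le_entropy i : (i < k)%N ->
  ((rate (letter i))%:E <= measure_entropy (push i) (T i))%E.
Proof.
move=> ik; pose c (z : borel (X i)) : A := [ffun j : 'I_k =>
  if (i <= j)%N then inord (b (j - i + i)%N (@tau_from _ _ p i (j - i)%N z)) else ord0].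
have -> : letter i = c \o tau p i.
  apply/funext => x; apply/ffunP => j; rewrite !ffunE; case: ifPn => // ij.
  rewrite tau_fromE; congr inord.
  pose G m := (b m (tau p m x) : nat).
  by rewrite -[LHS]/(G j) -[RHS]/(G (j - i + i)%N) subnK.
apply: (rate_le_entropy hT hp k_gt0 hmu ik).
apply: measurable_label_ffun => j; have jk := ltn_ord j.
have [ij|_] := leqP i j; last exact: measurable_label_cst.
have jik : (j - i + i < k)%N by rewrite subnK.
pose r (v : 'I_(N (j - i + i)%N).+1) : 'I_Nmax.+1 := inord v.
apply: (measurable_label_comp r
  (F := fun z : borel (X i) => b (j - i + i)%N (@tau_from _ _ p i (j - i)%N z))).
by apply: (measurable_label_continuous _ (mb jik)); exact: (continuous_tau_from hp).
Qed.

Lemma rate_le_chain_rate i : (i < k)%N ->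
  rate (b i \o tau p i) <= rate (letter i).
Proof.
move=> ik; apply: (rate_le mT0 hmu (mletter i)).
  exact: (measurable_label_continuous (ctau ik) (mb ik)).
move=> x y /= xy; apply: (@letter_inj i (Ordinal ik)) => //.
by rewrite xy.
Qed.

Let L : R := \sum_(i < k) a i * rate (letter i).

Let word n : borel (X 0%N) -> {ffun 'I_(total n) -> A} :=
  mixed T0 letter cut k.-1 (total n) n.

Let mword n : measurable_label (word n).
Proof. exact: measurable_mixed. Qed.
Arguments mword : clear implicits.

Let piece_length i n : (i < k)%N ->
  a i * n%:R - 1 <= (cut i.+1 n - cut i n)%:R <= a i * n%:R + 1.
Proof.
move=> ik; rewrite natrB ?cut_mono// cutS//.
have := duration_ge n ik; have := duration_lt n ik.
case: i ik => [|i] ik.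
  rewrite subr0 /partial_sum big_ord1.
  by move: (a 0%N * n%:R) => v *; apply/andP; split; lra.
rewrite cutS ?(ltnW ik)//.
have := duration_ge n (ltnW ik); have := duration_lt n (ltnW ik).
rewrite [partial_sum i.+1]big_ord_recr/= -/(partial_sum i) mulrDl.
by move: (a _ * n%:R) => v *; apply/andP; split; lra.
Qed.

Let mixed_rateE n : mixed_rate mu T0 letter cut k.-1 (total n) n =
  \sum_(i < k) rate (letter i) * (cut i.+1 n - cut i n)%:R.
Proof.
rewrite /mixed_rate /total -[in RHS](prednK k_gt0) big_ord_recr/=.
by rewrite [in LHS](_ : cut k n = cut k.-1.+1 n)// prednK.
Qed.

Let sum_rate : R := \sum_(i < k) rate (letter i).

Let rate0 i : 0 <= rate (letter i).
Proof. exact: rate_ge0. Qed.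

Let mixed_rate_bounds n :
  L * n%:R - sum_rate <= mixed_rate mu T0 letter cut k.-1 (total n) n <=
  L * n%:R + sum_rate.
Proof.
rewrite mixed_rateE /L /sum_rate mulr_suml -sumrB -big_split/=.
apply/andP; split; apply: ler_sum => i _; have /andP[lo hi] := piece_length n (ltn_ord i).
  have := ler_wpM2l (rate0 i) lo; move: (rate _) => v.
  by rewrite mulrBr mulr1 mulrCA mulrA.
have := ler_wpM2l (rate0 i) hi; move: (rate _) => v.
by rewrite mulrDr mulr1 mulrCA mulrA.
Qed.

Let evle_bounded (v : R) : evle (fun n _ => v) (fun n _ => 0).
Proof.
move=> e e0; apply: aeW => x; exists (Num.truncn (v / e)).+1 => // n /= vn.
have : v / e < n%:R by apply: lt_le_trans (truncnS_gt _) _; rewrite ler_nat.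
by rewrite ltr_pdivrMr// add0r mulrC => /ltW.
Qed.

(** The length of window i is a i * n up to rounding. *)
Lemma chain_info :
  evle (fun n => info (word n)) (fun n _ => L * n%:R) /\
  evle (fun n _ => L * n%:R) (fun n => info (word n)).
Proof.
have K_gt0 : (0 < K)%N by [].
have [|le ge] := @mixed_info _ _ _ mu _ mT0 hmu _ letter trunc mletter letterS
  cut K K_gt0 (fun=> erefl) cut_mono k.-1 total.
  by move=> n; rewrite total_le andbT /total -[in leqRHS](prednK k_gt0).
split; [apply: evle_trans le _|apply: evle_trans _ ge] => e e0;
  have := evle_bounded sum_rate e0; apply: filterS => x; apply: filterS => n;
  have /andP[] := mixed_rate_bounds n; move: (mixed_rate _ _ _ _ _ _ _) => *; lra.
Qed.

Let letter_piece n (t : nat) (j : 'I_k) : (t < cut j.+1 n)%N ->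
  (piece cut k.-1 n t <= j)%N.
Proof. exact: piece_le. Qed.

(** Points with the same mixed word stay eps-close in every system as long as
    the ball requires: at such a time the window index is at most i, hence the
    letter records the label of X i. *)
Lemma info_ball_le (eps : R) :
  (forall i, (i < k)%N -> forall x y : X i, b i x = b i y -> mdist x y < eps) ->
  forall e, 0 < e -> {ae mu, forall x, \forall n \near \oo,
    0 < pr (ball n x eps) /\ - ln (pr (ball n x eps)) <= (L + e) * n%:R}.
Proof.
move=> small e e0; have := chain_info.1 e e0.
have := ae_fibres_gt0 mu mword; apply: filterS2 => x pos; apply: filterS => n le.
have sub : fibre (word n) x `<=` ball n x eps.
  rewrite (fibre_window (mixed_letter T0 letter cut k.-1 n)) ballE => y h i j ik jc.
  apply: small => //.
  have jtot : (0 <= j < 0 + total n)%N.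
    by rewrite add0n (leq_trans jc)// cut_le.
  apply: (@letter_inj (piece cut k.-1 n j) (Ordinal ik)).
    exact: letter_piece.
  by have := h _ jtot; rewrite /mixed_letter => ->.
have prle : pr (fibre (word n) x) <= pr (ball n x eps).
  apply: le_pr sub; last exact: (measurable_ball n x eps).
  exact: (measurable_fibre x (mword n)).
have ball_gt0 : 0 < pr (ball n x eps) by exact: lt_le_trans (pos n) prle.
split=> //; rewrite mulrDl; apply: le_trans le.
by rewrite lerN2 ler_ln ?posrE ?pos.
Qed.

Let lt_piece n t (j : nat) : (j < k)%N -> (t < total n)%N ->
  (piece cut k.-1 n t <= j)%N -> (t < cut j.+1 n)%N.
Proof.
move=> jk tn; rewrite leqNgt; apply: contraNT; rewrite -leqNgt => jt.
have jk1 : (j < k.-1)%N.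
  rewrite ltn_neqAle -ltnS prednK// jk andbT; apply/eqP => jE.
  by move: jt; rewrite jE prednK// leqNgt tn.
rewrite /piece -(subnKC jk1) big_split_ord/= -[leqLHS]addn0; apply: leq_add => //.
rewrite -[leqLHS]card_ord -sum1_card; apply: leq_sum => i _.
rewrite lt0b; apply: leq_trans jt; apply: (@cut_le i.+1).
exact: (ltn_ord i).
Qed.

(** Lusin's theorem provides functions h j which, at a point close to an orbit
    point outside a small set, read off the letter of that orbit point. Points
    of the Bowen ball of x thus have h-words agreeing with the mixed word of x
    except at the rare times when the orbit of x visits the small set, and the
    noise argument applies. *)
Lemma pr_ball_le e : 0 < e -> exists2 eps, 0 < eps &
  {ae mu, forall x, \forall n \near \oo,
    pr (ball n x eps) <= expR (- ((L - e) * n%:R))}.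
Proof.
move=> e0; have K0 : 0 < K%:R :> R by rewrite ltr0n.
(* Three errors of size e / 4: the unmodified letters cost - ln (1 - th) each,
   the at most g K n modified ones cost C each, and the word of x has nearly the
   expected information. The fourth comes from the comparison itself. *)
pose th := 1 - expR (- (e / (4 * K%:R))).
have eK0 : 0 < e / (4 * K%:R) by rewrite divr_gt0// mulr_gt0.
have th01 : 0 < th < 1.
  by rewrite subr_gt0 expR_lt1 oppr_lt0 eK0/= gtrBl expR_gt0.
have /andP[th0 th1] := th01.
have A1 : 1 <= #|A|%:R :> R.
  by rewrite ler1n; apply/card_gt0P; exists (letter 0 point).
pose C := - ln (th / #|A|%:R).
have thA0 : 0 < th / #|A|%:R by rewrite divr_gt0// (lt_le_trans ltr01).
have C0 : 0 <= C.
  rewrite oppr_ge0 ln_le0// ler_pdivrMr ?(lt_le_trans ltr01)// mul1r.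
  exact: le_trans (ltW th1) A1.
have CE : expR (- C) = th / #|A|%:R by rewrite opprK lnK ?posrE.
pose g := e / (4 * K%:R * (C + 1)).
have g0 : 0 < g by rewrite divr_gt0// !mulr_gt0// ltr_wpDl.
have gk0 : 0 < g / (k%:R + 1) by rewrite divr_gt0// ltr_wpDl.
have /all_sig[w Hw] : forall j, {w : R * (X j -> 'I_(N j).+1) * set (X j) | (j < k)%N ->
    [/\ 0 < w.1.1, measurable_label (w.1.2 \o tau p j : borel (X 0%N) -> 'I_(N j).+1),
      measurable (tau p j @^-1` w.2 : set (borel (X 0%N))),
      pr (tau p j @^-1` w.2) < g / (k%:R + 1) &
      forall x y, ~ w.2 x -> mdist x y < w.1.1 -> w.1.2 y = b j x]}.
  move=> j; apply/cid; have [jk|_] := boolP (j < k)%N; last first.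
    by exists (1, b j, set0).
  have [eps [h [Z [? ? ? ? ?]]]] := stable_label mu
    (fun U oU => continuous_open_preimage (ctau jk) oU) (mb jk) gk0.
  by exists (eps, h, Z) => _; split.
pose v j (z : X j) : nat := (w j).1.2 z.
pose bad : set (borel (X 0%N)) := \bigcup_(j : 'I_k) tau p j @^-1` (w j).2.
have mZ (j : 'I_k) : measurable (tau p j @^-1` (w j).2 : set (borel (X 0%N))).
  by have [] := Hw j (ltn_ord j).
have mbad : measurable bad.
  by apply: fin_bigcup_measurable => [|j _]; [exact: finite_finset|exact: mZ].
have badg : pr bad < g.
  apply: le_lt_trans (pr_bigcup_le mu mZ) _.
  apply: (@le_lt_trans _ _ (\sum_(j < k) g / (k%:R + 1))).
    by apply: ler_sum => j _; have [_ _ _ /ltW] := Hw j (ltn_ord j).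
  rewrite sumr_const card_ord -[X in X < _]mulr_natr mulrAC ltr_pdivrMr ?ltr_wpDl//.
  by rewrite mulrDr mulr1 ltrDl.
pose eps := \big[Num.min/1]_(j < k) (w j).1.1.
have eps_gt0 : 0 < eps.
  by apply: lt_bigmin => // j _; have [] := Hw j (ltn_ord j).
exists eps => //.
pose ff n (t : 'I_(total n)) (y : borel (X 0%N)) : A :=
  chain_letter v (piece cut k.-1 n t) (iter t T0 y).
pose gg n (t : 'I_(total n)) (y : borel (X 0%N)) : A :=
  mixed_letter T0 letter cut k.-1 n (0 + t) y.
have mff n t : measurable_label (ff n t).
  pose F : borel (X 0%N) -> A := chain_letter v (piece cut k.-1 n t).
  suff mF : measurable_label F by exact: (measurable_label_iter t mT0 mF).
  apply: measurable_label_ffun => j.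
  have [_|_] := leqP (piece cut k.-1 n t) j; last exact: measurable_label_cst.
  pose r (u : 'I_(N j).+1) : 'I_Nmax.+1 := inord u.
  apply: (measurable_label_comp r (F := fun x : borel (X 0%N) => (w j).1.2 (tau p j x))).
  by have [] := Hw j (ltn_ord j).
have mgg n t : measurable_label (gg n t) by exact: measurable_label_iter.
have e40 : 0 < e / 4 by rewrite divr_gt0.
move: (ae_fibres_gt0 mu mword) (chain_info.2 _ e40).
move: (ae_visits_lt mT0 hmu mbad badg) (noisy_bound mu th01 e40 mff mgg).
move=> ae1 ae2 ae3 ae4; move: ae4; apply: filter_app; move: ae1 ae2 ae3.
apply: filterS3 => x [N1 _ vis] noise pos low.
move: low; apply: filter_app; move: noise; apply: filter_app.
exists N1 => // n /= N1n noisy low.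
pose J : {set 'I_(total n)} := [set t : 'I_(total n) | iter t T0 x \in bad]%SET.
have agree y (t : 'I_(total n)) : ball n x eps y -> t \notin J -> ff n t y = gg n t x.
  rewrite ballE => By tJ; apply/ffunP => j; rewrite !ffunE add0n.
  case: ifP => // pj; rewrite /v; congr inord; congr nat_of_ord.
  have [_ _ _ _] := Hw j (ltn_ord j); apply.
    by move=> Zx; move/negP: tJ; apply; rewrite inE; apply/mem_set; exists j.
  apply: lt_le_trans (By j t (ltn_ord j) (lt_piece _ _ pj)) _ => //.
  exact: bigmin_le.
have := noisy _ J (measurable_ball n x eps) agree.
have -> : (th / #|A|%:R) ^+ #|J| = expR (- (C * #|J|%:R)).
  by rewrite -CE -expRM_natr mulNr.
have -> : (1 - th) ^+ total n = expR (- (e / (4 * K%:R) * (total n)%:R)).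
  by rewrite /th subKr -expRM_natr mulNr.
have -> : pr (fibre (fun y => [ffun i => gg n i y]) x) = expR (- info (word n) x).
  by rewrite opprK lnK ?posrE ?pos.
have JE : #|J|%:R = orbit_visits R T0 bad (total n) x.
  rewrite /orbit_visits -sum1_card natr_sum big_mkcond/=; apply: eq_bigr => t _.
  by rewrite inE indicE; case: (_ \in _).
have Jle : C * #|J|%:R <= e / 4 * n%:R.
  have : #|J|%:R <= g * (K%:R * n%:R).
    have := vis (K * n)%N (leq_trans N1n (leq_pmull n _)).
    rewrite JE natrM => /(_ isT)/ltW; apply: le_trans.
    by rewrite -(subnKC (total_le n)) visitsD lerDl visits_ge0.
  move=> /(ler_wpM2l C0)/le_trans; apply.
  have -> : C * (g * (K%:R * n%:R)) = C / (C + 1) * (e / 4 * n%:R).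
    by rewrite /g; field; rewrite !gt_eqF// ltr_wpDl.
  have en0 : 0 <= e / 4 * n%:R by rewrite mulr_ge0// ltW.
  apply: ler_piMl => //.
  by rewrite ler_pdivrMr ?ltr_wpDl// mul1r lerDl.
have tle : e / (4 * K%:R) * (total n)%:R <= e / 4 * n%:R.
  apply: (@le_trans _ _ (e / (4 * K%:R) * (K%:R * n%:R))).
    by apply: ler_wpM2l; [exact: ltW|rewrite -natrM ler_nat total_le].
  by rewrite le_eqVlt; apply/orP; left; apply/eqP; field; rewrite gt_eqF.
rewrite -!expRD -ler_pdivlMr ?expR_gt0// -expRN -expRD => le.
by apply: le_trans le _; rewrite ler_expR; lra.
Qed.

Let L_le_weighted_entropy : (L%:E <= weighted_entropy k T p a mu)%E.
Proof.
rewrite /L -sumEFin; apply: lee_sum => i _; rewrite EFinM.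
by apply: lee_wpmul2l; [rewrite lee_fin a_ge0|exact: chain_rate_le_entropy].
Qed.

Let L_ge_rates : \sum_(i < k) a i * rate (b i \o tau p i) <= L.
Proof.
by apply: ler_sum => i _; apply: ler_wpM2l; [exact: a_ge0|exact: rate_le_chain_rate].
Qed.

Lemma info_ball_le_weighted_entropy (eps : R) :
  (forall i, (i < k)%N -> forall x y : X i, b i x = b i y -> mdist x y < eps) ->
  exists2 l : R, (l%:E <= weighted_entropy k T p a mu)%E &
  forall e, 0 < e -> {ae mu, forall x, \forall n \near \oo,
    0 < pr (ball n x eps) /\ - ln (pr (ball n x eps)) <= (l + e) * n%:R}.
Proof. by move=> small; exists L => // e; exact: info_ball_le. Qed.

Lemma pr_ball_le_label_entropies e : 0 < e -> exists2 eps, 0 < eps &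
  {ae mu, forall x, \forall n \near \oo, pr (ball n x eps) <=
    expR (- ((\sum_(i < k) a i * rate (b i \o tau p i) - e) * n%:R))}.
Proof.
move=> e0; have [eps eps0 le] := pr_ball_le e0; exists eps => //.
move: le; apply: (@filterS _ _ (ae_filter_ringOfSetsType mu)) => x.
apply: filterS => n le; apply: le_trans le _.
by rewrite ler_expR lerN2 ler_wpM2r// lerD2r.
Qed.

End WeightedChains.

(** * Limits of extended reals *)

Section ExtendedReals.
Variable R : realType.
Local Open Scope ereal_scope.

Lemma cvge_from_below (U : Type) (F : set_system U) {FF : Filter F}
    (f : U -> \bar R) (H : \bar R) : 0 <= H ->
  (\forall x \near F, f x <= H) ->
  (forall K : R, K%:E < H -> \forall x \near F, K%:E <= f x) -> f @ F --> H.
Proof.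
case: H => [r|_ _ lo|]; last by rewrite leNgt ltNyr.
  move=> _ up lo; apply/fine_cvgP; split.
    have lo1 : \forall x \near F, (r - 1)%:E <= f x.
      by apply: lo; rewrite lte_fin gtrBl.
    apply: filterS2 up lo1 => x up lo1; rewrite fin_numE.
    by apply/andP; split; apply/eqP => fx; move: up lo1; rewrite fx.
  apply/cvgrPdist_le => e e0.
  have loe : \forall x \near F, (r - e)%:E <= f x.
    by apply: lo; rewrite lte_fin gtrBl.
  apply: filterS2 up loe => x /=; case: (f x) => //= s.
  rewrite !lee_fin => sr rs; rewrite ger0_norm ?subr_ge0//.
  by rewrite lerBlDr -lerBlDl.
by apply/cvgeyPge => A; apply: lo; rewrite ltry.
Qed.

Lemma lt_adde_split (x y : \bar R) (K : R) : 0 <= x -> 0 <= y -> K%:E < x + y ->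
  exists K1 K2 : R, [/\ K1%:E < x, K2%:E < y & (K <= K1 + K2)%R].
Proof.
case: x => [x| |]; case: y => [y| |]//.
- move=> _ _; rewrite -EFinD lte_fin => Kxy; pose e : R := ((x + y - K) / 2)%R.
  exists (x - e)%R, (y - e)%R; split; rewrite ?lte_fin /e; lra.
- move=> _ _ _; exists (x - 1)%R, (K - x + 1)%R.
  by split; [rewrite lte_fin; lra|exact: ltry|lra].
- rewrite lee_fin => _ y0 _; exists (K + 1)%R, (- 1)%R.
  by split; [exact: ltry|rewrite lte_fin; lra|lra].
- by move=> _ _ _; exists K, 0%R; split; rewrite ?ltry// addr0.
Qed.

(** Split off one summand at a time. A summand with a i = 0 vanishes even when
    the supremum is infinite, and any element will do for it. *)
Lemma lt_sum_ereal_sup (k : nat) (a : nat -> R) (S : nat -> set R) (K : R) :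
  (forall i, (i < k)%N -> (0 <= a i)%R) ->
  (forall i, (i < k)%N -> exists2 v, S i v & (0 <= v)%R) ->
  K%:E < \sum_(i < k) (a i)%:E * ereal_sup [set v%:E | v in S i] ->
  exists2 v : nat -> R, (forall i, (i < k)%N -> S i (v i)) &
    (K < \sum_(i < k) a i * v i)%R.
Proof.
elim: k K => [|k ih] K a0 S0.
  by rewrite !big_ord0 => K0; exists (fun=> 0%R) => //; rewrite big_ord0 -lte_fin.
have sup0 i : (i < k.+1)%N -> 0 <= (a i)%:E * ereal_sup [set v%:E | v in S i].
  move=> ik; apply: mule_ge0; first by rewrite lee_fin a0.
  have [v Sv v0] := S0 i ik; apply: (@le_trans _ _ v%:E); first by rewrite lee_fin.
  by apply: ereal_sup_ubound; exists v.
rewrite big_ord_recr/= => /lt_adde_split[].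
- by apply: sume_ge0 => i _; apply: sup0; rewrite ltnS ltnW.
- exact: sup0.
move=> K1 [K2 [K1x aK2 KK]].
have a0k i : (i < k)%N -> (0 <= a i)%R by move=> ik; exact/a0/ltnW.
have S0k i : (i < k)%N -> exists2 v, S i v & (0 <= v)%R by move=> ik; exact/S0/ltnW.
have [v Sv vK1] := ih K1 a0k S0k K1x.
have [u Su uK2] : exists2 u, S k u & (K2 < a k * u)%R.
  have [ak0|ak0] := eqVneq (a k) 0%R.
    move: aK2; rewrite ak0 mul0e lte_fin => K20.
    by have [u Su _] := S0 k (ltnSn k); exists u => //; rewrite mul0r.
  have {}ak0 : (0 < a k)%R by rewrite lt0r ak0 a0.
  have /ereal_sup_gt[_ [u Su <-]] : (K2 / a k)%:E < ereal_sup [set v%:E | v in S k].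
    by rewrite -(@lte_pmul2l _ (a k)%:E)// -EFinM mulrC divfK// gt_eqF.
  rewrite lte_fin ltr_pdivrMr// => lt; exists u => //.
  by rewrite mulrC.
exists (fun i => if (i < k)%N then v i else u).
  move=> i; rewrite ltnS leq_eqVlt => /predU1P[->|ik]; first by rewrite ltnn.
  by rewrite ik; exact: Sv.
rewrite big_ord_recr/= ltnn; apply: le_lt_trans KK _; apply: ltrD => //.
by rewrite (eq_bigr (fun i : 'I_k => a i * v i)%R)// => i _; rewrite ltn_ord.
Qed.

Lemma limn_esup_le (u : nat -> \bar R) (c : \bar R) :
  (\forall n \near \oo, u n <= c) -> limn_esup u <= c.
Proof.
move=> uc; apply: ge_ereal_inf; exists (ereal_sup (u @` [set n | u n <= c])).
  by exists [set n | u n <= c].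
by apply: ge_ereal_sup => _ [n /= un <-].
Qed.

Lemma limn_einf_ge (u : nat -> \bar R) (c : \bar R) :
  (\forall n \near \oo, c <= u n) -> c <= limn_einf u.
Proof.
move=> cu; rewrite leeNr; apply: limn_esup_le.
by apply: filterS cu => n; rewrite leeN2.
Qed.

End ExtendedReals.

(** * The weighted Brin-Katok formula *)

Section WeightedBrinKatok.
Variables (R : realType) (k : nat) (X : nat -> pmetricType R).
Variables (T : forall i, X i -> X i) (p : forall i, X i -> X i.+1).
Arguments T : clear implicits.
Arguments p : clear implicits.
Hypothesis hT : forall i, (i < k)%N -> topological_dynamical_system (T i).
Hypothesis hp : forall i, (i.+1 < k)%N -> factor_map (T i) (T i.+1) (p i).
Hypothesis k_gt0 : (0 < k)%N.
Variable mu : probability (borel (X 0%N)) R.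
Hypothesis hmu : ergodic_measure mu (T 0%N).
Variable a : nat -> R.
Hypothesis a_ge0 : forall i, (i < k)%N -> 0 <= a i.

Local Notation T0 := (T 0%N : borel (X 0%N) -> borel (X 0%N)).
Local Notation push i := (pushforward mu (tau p i : borel (X 0%N) -> borel (X i))).
Local Notation pr := (real_pr mu).
Local Notation ball n x eps := (weighted_Bowen_ball k T p a n x eps).
Local Notation W := (weighted_entropy k T p a mu).

Definition ball_rate (x : X 0%N) (eps : R) (n : nat) : \bar R :=
  (- lne (mu (ball n x eps)) / n%:R%:E)%E.

Let mball n x eps : measurable (ball n x eps : set (borel (X 0%N))).
Proof. exact: measurable_ball. Qed.

Let le_pr_ball n x eps eps' : eps <= eps' -> pr (ball n x eps) <= pr (ball n x eps').
Proof.
move=> le; apply: (le_pr mu (mball n x eps) (mball n x eps')) => y By i j ik jn.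
exact: lt_le_trans (By i j ik jn) le.
Qed.

Let ball_rate_le x eps n c : (0 < n)%N -> 0 < pr (ball n x eps) ->
  - ln (pr (ball n x eps)) <= c * n%:R -> (ball_rate x eps n <= c%:E)%E.
Proof.
move=> n0 pos le; have n0R : 0 < n%:R :> R by rewrite ltr0n.
rewrite /ball_rate (prE mu (mball n x eps)) lne_EFin// inver gt_eqF//.
by rewrite -EFinN -EFinM lee_fin ler_pdivrMr.
Qed.

Let ball_rate_ge x eps n c : (0 < n)%N ->
  pr (ball n x eps) <= expR (- (c * n%:R)) -> (c%:E <= ball_rate x eps n)%E.
Proof.
move=> n0 le; have n0R : 0 < n%:R :> R by rewrite ltr0n.
rewrite /ball_rate (prE mu (mball n x eps)) inver gt_eqF//.
have [pos|neg] := ltP 0 (pr (ball n x eps)); last first.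
  by rewrite le0_lneNy// gt0_mulye ?leey// lte_fin invr_gt0.
rewrite lne_EFin// -EFinN -EFinM lee_fin ler_pdivlMr// lerNr -ler_expR lnK//.
Qed.

(** Balls increase with their radius, so countably many radii suffice. *)
Lemma ae_limn_esup_le :
  {ae mu, forall x, forall eps, 0 < eps -> (limn_esup (ball_rate x eps) <= W)%E}.
Proof.
pose eps r : R := r.+1%:R^-1.
have eps0 r : 0 < eps r by rewrite invr_gt0.
have /choice[l Hl] : forall r, exists l : R, (l%:E <= W)%E /\
    forall e, 0 < e -> {ae mu, forall x, \forall n \near \oo,
      0 < pr (ball n x (eps r)) /\ - ln (pr (ball n x (eps r))) <= (l + e) * n%:R}.
  move=> r.
  have /all_sig[w Hw] : forall i, {w : {N : nat & borel (X i) -> 'I_N.+1} | (i < k)%N ->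
      measurable_label (tagged w) /\
      forall x y : X i, tagged w x = tagged w y -> mdist x y < eps r}.
    move=> i; apply/cid; have [ik|_] := boolP (i < k)%N; last first.
      by exists (Tagged (fun N => borel (X i) -> 'I_N.+1) (fun=> ord0 : 'I_1)).
    have [N [c [mc cP]]] := small_label (hT ik).1 (eps0 r).
    by exists (Tagged (fun N => borel (X i) -> 'I_N.+1) c).
  have [||l] := @info_ball_le_weighted_entropy R k X T p hT hp k_gt0 mu hmu a a_ge0
    (fun i => tag (w i)) (fun i => tagged (w i)) _ (eps r).
  - by move=> i ik; have [] := Hw i ik.
  - by move=> i ik; have [] := Hw i ik.
  by move=> lW H; exists l.
have : {ae mu, forall x, forall r q, \forall n \near \oo,
    0 < pr (ball n x (eps r)) /\ - ln (pr (ball n x (eps r))) <= (l r + eps q) * n%:R}.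
  by apply/ae_foralln => r; apply/ae_foralln => q; exact: (Hl r).2.
apply: (@filterS _ _ (ae_filter_ringOfSetsType mu)) => x H e e0.
pose r := Num.truncn e^-1.
have re : eps r <= e.
  by rewrite invf_ple ?posrE//; apply/ltW/truncnS_gt.
apply: le_trans (Hl r).1; apply/lee_addgt0Pr => d d0.
pose q := Num.truncn d^-1.
have qd : eps q <= d.
  by rewrite invf_ple ?posrE//; apply/ltW/truncnS_gt.
apply: (@le_trans _ _ (l r + eps q)%:E); last by rewrite EFinD leeD2l// lee_fin.
apply: limn_esup_le; have [N _ HN] := H r q; exists (maxn N 1) => // n /=.
rewrite geq_max => /andP[Nn n0]; have [pos le] := HN n Nn.
have lep := le_pr_ball n x re; have pose' := lt_le_trans pos lep.
apply: ball_rate_le => //; apply: le_trans le.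
by rewrite lerN2 ler_ln ?posrE.
Qed.

Lemma ae_limn_einf_ge (c : R) : (c%:E < W)%E -> exists2 eps0, 0 < eps0 &
  {ae mu, forall x, forall eps, eps <= eps0 ->
    (c%:E <= limn_einf (ball_rate x eps))%E}.
Proof.
move=> cW.
pose S i : set R := [set v | exists N, exists xi : 'I_N -> set (borel (X i)),
  measurable_partition xi /\ v = entropy_wrt_partition (push i) (T i) xi].
have SE i : measure_entropy (push i) (T i) = ereal_sup [set v%:E | v in S i].
  congr ereal_sup; apply/seteqP; split=> h.
    move=> [N [xi [pxi ->]]]; exists (entropy_wrt_partition (push i) (T i) xi) => //.
    by exists N, xi.
  by move=> [_ [N [xi [pxi ->]]] <-]; exists N, xi.
have Sge0 i : (i < k)%N -> exists2 v, S i v & 0 <= v.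
  move=> ik; pose b (_ : borel (X i)) : 'I_1 := ord0.
  have mb : measurable_label b by exact: measurable_label_cst.
  exists (entropy_wrt_partition (push i) (T i) (fun v => b @^-1` [set v])).
    by exists 1%N, (fun v => b @^-1` [set v]); split=> //; exact: measurable_partition_fibres.
  rewrite (entropy_rate hp mu b ik).
  apply: (rate_ge0 (measurable_T0 hT k_gt0) hmu).
  exact: (measurable_label_continuous (continuous_tau hp ik) mb).
move: cW; rewrite /weighted_entropy; under eq_bigr do rewrite SE.
move=> /(lt_sum_ereal_sup a_ge0 Sge0)[v Sv cv].
have /all_sig[w Hw] : forall i, {w : {N : nat & borel (X i) -> 'I_N.+1} | (i < k)%N ->
    measurable_label (tagged w) /\ process_entropy mu T0 (tagged w \o tau p i) = v i}.
  move=> i; apply/cid; have [ik|_] := boolP (i < k)%N; last first.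
    by exists (Tagged (fun N => borel (X i) -> 'I_N.+1) (fun=> ord0 : 'I_1)).
  have [N [xi [/label_of_partition[b mb xiE] vE]]] := Sv i ik.
  case: N b xi mb xiE vE => [b|N b] xi mb xiE vE; first by case: (b point).
  exists (Tagged (fun N => borel (X i) -> 'I_N.+1) b) => _; split=> //=.
  by rewrite vE xiE (entropy_rate hp mu b ik).
have e0 : 0 < \sum_(i < k) a i * v i - c by rewrite subr_gt0.
have [|eps0 eps00 le] := @pr_ball_le_label_entropies R k X T p hT hp k_gt0 mu hmu a a_ge0
    (fun i => tag (w i)) (fun i => tagged (w i)) _ _ e0.
  by move=> i ik; have [] := Hw i ik.
exists eps0 => //; move: le.
apply: (@filterS _ _ (ae_filter_ringOfSetsType mu)) => x [N _ HN] eps epsle.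
apply: limn_einf_ge; exists (maxn N 1) => // n /=; rewrite geq_max => /andP[Nn n0].
apply: ball_rate_ge => //; apply: le_trans (le_pr_ball n x epsle) _.
apply: le_trans (HN n Nn) _; rewrite ler_expR lerN2 ler_wpM2r//.
rewrite (eq_bigr (fun i : 'I_k => a i * v i)) => [|i _]; last first.
  by have [_ ->] := Hw i (ltn_ord i).
by rewrite subKr.
Qed.

Lemma weighted_entropy_ge0 : (0 <= W)%E.
Proof.
apply: sume_ge0 => i _; apply: mule_ge0; first by rewrite lee_fin a_ge0.
exact: (entropy_ge0 hT hp k_gt0 hmu).
Qed.

Lemma weighted_Brin_Katok : {ae mu, forall x : X 0%N,
  (limn_einf (ball_rate x eps) @[eps --> 0^'+] --> W) /\
  (limn_esup (ball_rate x eps) @[eps --> 0^'+] --> W)}.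
Proof.
(* Countably many values c r below the weighted entropy, to intersect countably
   many events only. *)
have [c cW cP] : exists2 c : nat -> R, (forall r, (c r)%:E < W)%E &
    forall K, (K%:E < W)%E -> exists r, K <= c r.
  have := weighted_entropy_ge0; case: W => [w _| _|//].
    exists (fun r => w - r.+1%:R^-1); first by move=> r; rewrite lte_fin gtrBl invr_gt0.
    move=> K; rewrite lte_fin => Kw; exists (Num.truncn (w - K)^-1).
    rewrite lerBrDr -lerBrDl invf_ple ?posrE ?subr_gt0//.
    exact/ltW/truncnS_gt.
  exists (fun r => r%:R) => [r|K _]; first exact: ltry.
  exists (Num.truncn K).+1; exact/ltW/truncnS_gt.
have /choice[e0 He0] : forall r, exists e0 : R, 0 < e0 /\
    {ae mu, forall x, forall eps, eps <= e0 ->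
      ((c r)%:E <= limn_einf (ball_rate x eps))%E}.
  by move=> r; have [e0 ? ?] := ae_limn_einf_ge (cW r); exists e0.
have := ae_limn_esup_le.
have : {ae mu, forall x, forall r eps, eps <= e0 r ->
    ((c r)%:E <= limn_einf (ball_rate x eps))%E}.
  by apply/ae_foralln => r; exact: (He0 r).2.
apply: (@filterS2 _ _ (ae_filter_ringOfSetsType mu)) => x lo up.
have low K : (K%:E < W)%E -> \forall eps \near 0^'+,
    (K%:E <= limn_einf (ball_rate x eps))%E.
  move=> /cP[r Kr]; near=> eps; apply: (@le_trans _ _ (c r)%:E); first by rewrite lee_fin.
  by apply: lo; near: eps; apply: nbhs_right_le; exact: (He0 r).1.
have upp : \forall eps \near 0^'+, (limn_esup (ball_rate x eps) <= W)%E.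
  by near=> eps; apply: up.
split; apply: cvge_from_below weighted_entropy_ge0 _ _.
- by apply: filterS upp => eps; apply: le_trans; exact: limn_einf_sup.
- exact: low.
- exact: upp.
by move=> K /low; apply: filterS => eps /le_trans; apply; exact: limn_einf_sup.
Unshelve. all: by end_near. Qed.

End WeightedBrinKatok.

Theorem theorem4p1 (R : realType) (k : nat) (hk : (2 <= k)%N)
    (X : nat -> pmetricType R)
    (T : forall i, X i -> X i)
    (p : forall i, X i -> X i.+1)
    (hT : forall i, (i < k)%N -> topological_dynamical_system (T i))
    (hp : forall i, (i.+1 < k)%N -> factor_map (T i) (T i.+1) (p i))
    (a : nat -> R)
    (ha0 : 0 < a 0%N)
    (ha : forall i, (0 < i < k)%N -> 0 <= a i)
    (mu : probability (borel (X 0%N)) R)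
    (hmu : ergodic_measure mu (T 0%N)) :
  {ae mu, forall x : X 0%N,
    (limn_einf (fun n : nat =>
        - lne (mu (weighted_Bowen_ball k T p a n x eps)) / n%:R%:E)%E
      @[eps --> 0^'+] --> weighted_entropy k T p a mu) /\
    (limn_esup (fun n : nat =>
        - lne (mu (weighted_Bowen_ball k T p a n x eps)) / n%:R%:E)%E
      @[eps --> 0^'+] --> weighted_entropy k T p a mu)}.
Proof.
have k_gt0 : (0 < k)%N by exact: leq_trans hk.
have a_ge0 i : (i < k)%N -> 0 <= a i.
  by case: i => [_|i ik]; [exact: ltW|exact: ha].
exact: (weighted_Brin_Katok hT hp k_gt0 hmu a_ge0).
Qed.
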